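(* Let $n=1$, $N\ge2$. For $1\le k\le N-1$ let $U_{0,k}=(u_1,\dots,u_N):\mathbb R\to\mathbb R^N$ be given by $$u_i(x)=\sqrt{\tfrac1k-\tfrac1N}\;x^+\ \text{ for } i\le k,\qquad u_i(x)=-\sqrt{\tfrac1{N-k}-\tfrac1N}\;x^+\ \text{ for } i>k.$$ Then the functions $U_{0,k}$, $1\le k\le N-1$, are, up to the reflection $x\mapsto -x$, exactly the minimizing cones $U$ of $J_N$ in dimension $n=1$ that satisfy $\sum_{i=1}^N u_i=0$ and $0\in\partial\{|U|>0\}$.
   Context: For a bounded open interval $\Omega\subset\mathbb R$ and $N\ge2$, let $\mathcal A=\{U=(u_1,\dots,u_N)\in H^1(\Omega;\mathbb R^N): u_1\ge u_2\ge\dots\ge u_N\}$ and $$J_N(U,\Omega)=\int_\Omega\Big(\sum_{i=1}^N|u_i'|^2+\sum_{i=1}^{N-1}\chi_{\{u_i>u_{i+1}\}}\Big)\,dx.$$ $U\in\mathcal A$ is a minimizer in $\Omega$ if $J_N(U,\Omega)\le J_N(V,\Omega)$ for all $V\in\mathcal A$ with $V-U\in H^1_0(\Omega)$. A minimizing cone is a function $U:\mathbb R\to\mathbb R^N$ that is homogeneous of degree one (i.e. $U(tx)=tU(x)$ for $t>0$) and is a minimizer in every bounded open interval. $x^+=\max\{x,0\}$. *)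

(* Defs.v *)
From HB Require Import structures.
From mathcomp Require Import all_boot all_order all_algebra.
From mathcomp Require Import all_classical all_reals all_analysis.

Set Implicit Arguments.
Unset Strict Implicit.
Unset Printing Implicit Defensive.

Import Order.TTheory GRing.Theory Num.Theory.
Import numFieldNormedType.Exports.

Local Open Scope classical_set_scope.
Local Open Scope ring_scope.

(** Sobolev spaces on the interval `]a, b[, following Brezis, Functional
    Analysis, Sobolev Spaces and PDE, Chapter 8: the test functions are C^1 with
    compact support.  Functions are total on R, but only their restriction to
    `]a, b[ matters. *)

Definition C1c {R : realType} (a b : R) (phi : R -> R) : Prop :=
  [/\ forall x, derivable phi x 1,
      continuous (derive1 phi),
      compact (closure [set x | phi x != 0]) &
      closure [set x | phi x != 0] `<=` `]a, b[%classic].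

(* The zero extension [u \_ D] lets the library's L^p spaces on the whole line
   express L^2(D). *)
Definition L2 {R : realType} (a b : R) (u : R -> R) : Prop :=
  u \_ `]a, b[%classic \in Lfun (@lebesgue_measure R) 2%:E.

Definition L2norm {R : realType} (a b : R) (u : R -> R) : \bar R :=
  ('N[@lebesgue_measure R]_2%:E [EFin \o (u \_ `]a, b[%classic)])%E.

Definition is_weak_derivative {R : realType} (a b : R) (u g : R -> R) : Prop :=
  L2 a b g /\
  forall phi, C1c a b phi ->
    (\int[@lebesgue_measure R]_(x in `]a, b[) (u x * derive1 phi x)%:E =
     - \int[@lebesgue_measure R]_(x in `]a, b[) (g x * phi x)%:E)%E.

Definition H1 {R : realType} (a b : R) (u : R -> R) : Prop :=
  L2 a b u /\ exists g, is_weak_derivative a b u g.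

(* A chosen representative of the weak derivative, which is unique almost
   everywhere; junk value 0 if there is none. *)
Definition weak_derivative {R : realType} (a b : R) (u : R -> R) : R -> R :=
  xget (fun=> 0) [set g | is_weak_derivative a b u g].

Definition H1norm {R : realType} (a b : R) (u : R -> R) : \bar R :=
  (L2norm a b u + L2norm a b (weak_derivative a b u))%E.

(* H^1_0 is the closure of the test functions in the H^1 norm. *)
Definition H10 {R : realType} (a b : R) (u : R -> R) : Prop :=
  H1 a b u /\
  forall eps : R, 0 < eps ->
    exists2 phi, C1c a b phi & (H1norm a b (u \- phi)%R < eps%:E)%E.

(** A map into R^N is a function into row vectors, whose components are numbered
    from 0: [component U i] is u_(i+1). *)

Definition component {R : realType} {N : nat} (U : R -> 'rV[R]_N) (i : 'I_N) :
  R -> R := fun x => U x ord0 i.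

(* Elements of H^1 are defined up to null sets, hence the ordering is imposed
   almost everywhere. *)
Definition admissible {R : realType} {N : nat} (a b : R)
    (U : R -> 'rV[R]_N) : Prop :=
  (forall i, H1 a b (component U i)) /\
  {ae (@lebesgue_measure R), forall x, x \in `]a, b[ ->
     forall i j : 'I_N, (i <= j)%N -> component U j x <= component U i x}.

(* The double sum ranges over the N - 1 consecutive pairs (i, i + 1). *)
Definition JN {R : realType} {N : nat} (a b : R) (U : R -> 'rV[R]_N) : \bar R :=
  (\int[@lebesgue_measure R]_(x in `]a, b[)
    (\sum_(i < N) `|weak_derivative a b (component U i) x| ^+ 2 +
     \sum_(i < N) \sum_(j < N | j == i.+1 :> nat)
        \1_[set y | (component U j y < component U i y)%R] x)%R%:E)%E.

Definition minimizer {R : realType} {N : nat} (a b : R)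
    (U : R -> 'rV[R]_N) : Prop :=
  admissible a b U /\
  forall V : R -> 'rV[R]_N, admissible a b V ->
    (forall i, H10 a b (component V i \- component U i)) ->
    (JN a b U <= JN a b V)%E.

Definition homogeneous1 {R : realType} {N : nat} (U : R -> 'rV[R]_N) : Prop :=
  forall t x, 0 < t -> U (t * x) = t *: U x.

Definition minimizing_cone {R : realType} {N : nat}
    (U : R -> 'rV[R]_N) : Prop :=
  homogeneous1 U /\ forall a b : R, a < b -> minimizer a b U.

(* The library norm on row vectors is the sup norm. *)
Definition euclidean_norm {R : realType} {N : nat} (v : 'rV[R]_N) : R :=
  Num.sqrt (\sum_(i < N) v ord0 i ^+ 2).

Definition boundary {T : topologicalType} (A : set T) : set T :=
  closure A `\` A^°.

Definition pospart {R : realType} (x : R) : R := Num.max x 0.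

(* As components are numbered from 0, the first k ones are those of index
   i < k. *)
Definition U0 {R : realType} (N k : nat) (x : R) : 'rV[R]_N :=
  \row_(i < N)
    if (i < k)%N then Num.sqrt (k%:R^-1 - N%:R^-1) * pospart x
    else - Num.sqrt ((N - k)%N%:R^-1 - N%:R^-1) * pospart x.

(* Main.v *)
(** A homogeneous [U] is [A x^+ + B x^-] with [A], [B] nonincreasing of sum zero.

    Sufficiency is a calibration argument.  Let [c = U0 N k 1], a unit vector,
    and [l = <c, V>] for a competitor [V].  The ordering gives [l >= 0], and
    [l > 0] forces some gap to be open, so the energy density of [V] is at least
    [l'^2 + 1_{l > 0}], hence at least [2 l'] (up to the sign of the reflection)
    because [l' = 0] almost everywhere on [{l = 0}].  The integral of [l'] depends
    only on the boundary values, and equality holds for [U].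

    Necessity compares [U] with two perturbations near the kink.  Let [m] be the
    number of gaps of [A].  Opening all gaps of [A] later gives [|A|^2 >= m].
    For a gap of [A], let [P] be the projection of [A] onto the vectors whose only
    gap is that one; starting [P] earlier gives [|P|^2 + 2 <B, P> <= 1].  Abel
    summation writes [|A|^2] as a sum over the gaps of terms bounded by [|P|^2],
    so all inequalities are equalities: [A = P], [|P| = 1] and [<B, P> = 0],
    whence [B = 0]. *)
Require Import Defs.
From mathcomp Require Import all_boot all_order all_algebra.
From mathcomp Require Import all_classical all_reals all_analysis.
From mathcomp Require Import measurable_realfun.
From mathcomp Require Import ring lra.
Set Implicit Arguments.
Unset Strict Implicit.
Unset Printing Implicit Defensive.
Import Order.TTheory GRing.Theory Num.Theory.
Import numFieldNormedType.Exports.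
Local Open Scope classical_set_scope.
Local Open Scope ring_scope.

(** * Square-integrable functions on an interval *)

(** Weak derivatives are accessible only through test functions, and this shapes the two analytic
    facts behind the calibration. That [l'] vanishes almost everywhere on [l = 0] comes from testing
    against smoothed indicators and passing to Lebesgue points; that its integral depends only on
    boundary values holds because derivatives of test functions have integral 0 and test functions
    are dense in [H10].

    Both perturbations have the form [cone + dent t * W]: [W = A] with [t > 0] for the late kink,
    [W = P] with [t < 0] for the early one. The energy changes to first order in [t], so letting [t]
    tend to 0 gives the two inequalities. The direction [P] suits the early kink because it is
    ordered, adds at most one gap to those of [B], and satisfies [<A, P> = |P|^2], so the cost on
    the side of [A] involves nothing of [A] but [P].

    The sign of [<B, P>] is that of a partial sum of [B]. Partial sums of an ordered vector of sum
    zero are nonnegative, and one interior partial sum equal to 0 already forces the vector to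
    vanish; this is how [<B, P> = 0] yields [B = 0]. *)

Lemma integrable_EFinD d (T : measurableType d) (R : realType)
    (mu : {measure set T -> \bar R}) (A : set T) (f g : T -> R) : measurable A ->
  mu.-integrable A (EFin \o f) -> mu.-integrable A (EFin \o g) ->
  mu.-integrable A (EFin \o (f \+ g)).
Proof.
move=> mA fi gi; rewrite (_ : EFin \o _ = (EFin \o f) \+ (EFin \o g))%E //.
exact: integrableD.
Qed.

Lemma integrable_EFinZ d (T : measurableType d) (R : realType)
    (mu : {measure set T -> \bar R}) (A : set T) (f : T -> R) (k : R) :
  measurable A -> mu.-integrable A (EFin \o f) ->
  mu.-integrable A (EFin \o (fun x => k * f x)).
Proof. by move=> mA fi; have := integrableZl mA k fi. Qed.

Section Interval.
Context {R : realType}.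
Notation mu := (@lebesgue_measure R).
Implicit Types (a b : R) (u v f g h phi : R -> R).

Local Notation "D[ a , b ]" := (`]a, b[%classic : set R).

Lemma measurable_oo a b : @measurable _ (measurableTypeR R) D[a, b].
Proof. exact: measurable_itv. Qed.

Lemma lebesgue_oo_lty a b : (mu D[a, b] < +oo)%E.
Proof. by rewrite lebesgue_measure_itv /=; case: ifP => _; rewrite ?ltry. Qed.

Lemma bounded_byP (T : Type) (A : set T) (f : T -> R) (M : R) :
  (forall x, A x -> `|f x| <= M) -> [bounded f x | x in A].
Proof.
move=> fM; exists M; split; first exact: num_real.
by move=> y My x Ax; apply: (le_trans (fM _ Ax)); exact: ltW.
Qed.

Lemma integrable_bounded a b f (M : R) : measurable_fun D[a, b] f ->
  (forall x, D[a, b] x -> `|f x| <= M) ->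
  mu.-integrable D[a, b] (EFin \o f).
Proof.
move=> mf fM; apply: measurable_bounded_integrable => //.
  exact: lebesgue_oo_lty.
exact: bounded_byP fM.
Qed.

Lemma integrable_mulb a b u f (M : R) : mu.-integrable D[a, b] (EFin \o u) ->
  measurable_fun D[a, b] f -> (forall x, D[a, b] x -> `|f x| <= M) ->
  mu.-integrable D[a, b] (EFin \o (u \* f)).
Proof.
move=> iu mf fM.
have -> : EFin \o (u \* f) = ((EFin \o u) \* (EFin \o f))%E by [].
by apply: integrableMl => //; exact: bounded_byP fM.
Qed.

Lemma L2P a b u : L2 a b u <->
  measurable_fun D[a, b] u /\
  mu.-integrable D[a, b] (EFin \o (fun x => u x ^+ 2)).
Proof.
have sqE : (fun x => (u \_ D[a, b]) x ^+ 2) = (fun x => u x ^+ 2) \_ D[a, b].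
  by apply/funext => x; rewrite /patch; case: ifP => // _; rewrite expr0n.
split=> [Lu|[mu_ iu]].
- split.
    apply/measurable_restrictT => //.
    by have := sub_Lfun_mfun Lu; rewrite inE.
  have := Lfun2_integrable_sqr Lu; rewrite sqE.
  rewrite -restrict_EFin => H.
  by apply/integrable_mkcond; [exact: measurable_itv|exact: H].
- rewrite /L2 inE; apply/andP; split; rewrite inE /=.
    by apply/(measurable_restrictT _ _).1.
  rewrite /finite_norm unlock /= poweR_lty //.
  move/integrable_mkcond: iu => /(_ (measurable_itv _)).
  rewrite restrict_EFin -sqE => /integrableP[_].
  apply: le_lt_trans; rewrite le_eqVlt; apply/orP; left; apply/eqP.
  by apply: eq_integral => x _ /=; rewrite normrX -powR_mulrn.
Qed.

Lemma L2_measurable a b u : L2 a b u -> measurable_fun D[a, b] u.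
Proof. by case/L2P. Qed.

Lemma L2_sqr_integrable a b u :
  L2 a b u -> mu.-integrable D[a, b] (EFin \o (fun x => u x ^+ 2)).
Proof. by case/L2P. Qed.

(** On a bounded interval constants are integrable, and [|u| <= 1 + u ^ 2] gives the domination. *)
Lemma L2_integrable a b u : L2 a b u -> mu.-integrable D[a, b] (EFin \o u).
Proof.
case/L2P => mu_ iu.
have i1 : mu.-integrable D[a, b] (EFin \o (fun x => 1 + u x ^+ 2)).
  apply: integrable_EFinD => //.
  by apply: (@integrable_bounded _ _ _ 1) => // x _; rewrite normr1.
apply: le_integrable i1 => //; first exact/measurable_EFinP.
move=> x _ /=; rewrite lee_fin.
rewrite [leRHS]ger0_norm; last by rewrite addr_ge0 // sqr_ge0.
rewrite -real_normK ?num_real //.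
have := sqr_ge0 (`|u x| - 1); have := normr_ge0 (u x); nra.
Qed.

Lemma L2_bounded a b f (M : R) : measurable_fun D[a, b] f ->
  (forall x, D[a, b] x -> `|f x| <= M) -> L2 a b f.
Proof.
move=> mf fM; apply/L2P; split => //.
apply: (@integrable_bounded _ _ _ (M ^+ 2)); first exact: measurable_funX.
by move=> x Dx; rewrite normrX lerXn2r ?nnegrE ?(le_trans _ (fM _ Dx)) // fM.
Qed.

Lemma L2D a b u v : L2 a b u -> L2 a b v -> L2 a b (u \+ v).
Proof.
move=> /L2P[mu_ iu] /L2P[mv iv]; apply/L2P; split.
  exact: measurable_funD.
have i2 : mu.-integrable D[a, b]
    (EFin \o (fun x => 2 * (u x ^+ 2 + v x ^+ 2))).
  by apply: integrable_EFinZ => //; exact: integrable_EFinD.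
apply: le_integrable i2 => //.
  by apply/measurable_EFinP/measurable_funX; exact: measurable_funD.
move=> x _ /=; rewrite lee_fin !ger0_norm ?sqr_ge0 //; last first.
  by rewrite mulr_ge0 // addr_ge0 // sqr_ge0.
have := sqr_ge0 (u x - v x); nra.
Qed.

Lemma L2Z a b u (k : R) : L2 a b u -> L2 a b (fun x => k * u x).
Proof.
move=> /L2P[mu_ iu]; apply/L2P; split; first exact: measurable_funM.
have := integrable_EFinZ (k ^+ 2) (measurable_oo a b) iu.
by apply: eq_integrable => // x _ /=; rewrite exprMn.
Qed.

Lemma eq_L2 a b u v : {in D[a, b], u =1 v} -> L2 a b u -> L2 a b v.
Proof.
move=> uv; rewrite /L2 (_ : v \_ _ = u \_ D[a, b]) //.
by apply/funext => x; rewrite /patch; case: ifPn => // xD; rewrite uv.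
Qed.

Lemma L2normE a b h : L2 a b h ->
  L2norm a b h = (Num.sqrt (\int[mu]_(x in D[a, b]) (h x ^+ 2)))%:E.
Proof.
move=> Lh; have [mh ih] := (L2P a b h).1 Lh.
have sqE : (fun x => (h \_ D[a, b]) x ^+ 2) = (fun x => h x ^+ 2) \_ D[a, b].
  by apply/funext => x; rewrite /patch; case: ifP => // _; rewrite expr0n.
have I0 : 0 <= \int[mu]_(x in D[a, b]) (h x ^+ 2).
  by apply: Rintegral_ge0 => x _; exact: sqr_ge0.
rewrite /L2norm unlock /=.
under eq_integral do rewrite powR_mulrn ?normr_ge0 // -normrX ger0_norm ?sqr_ge0 //.
have -> : (\int[mu]_x ((h \_ D[a, b]) x ^+ 2)%:E =
           (\int[mu]_(x in D[a, b]) (h x ^+ 2))%R%:E)%E.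
  rewrite /Rintegral fineK ?(integrable_fin_num (measurable_oo a b) ih) //.
  by rewrite [RHS]integral_mkcond restrict_EFin -sqE.
by rewrite poweR_EFin powR12_sqrt.
Qed.

End Interval.

(** * Weak derivatives *)

Section WeakDerivative.
Context {R : realType}.
Notation mu := (@lebesgue_measure R).
Implicit Types (a b : R) (u v f g h F phi : R -> R).

Local Notation "D[ a , b ]" := (`]a, b[%classic : set R).

Lemma derivable_continuous f : (forall x, derivable f x 1) -> continuous f.
Proof. by move=> df x; apply/differentiable_continuous/derivable1_diffP. Qed.

Lemma continuous_bounded_itv a b f : continuous f ->
  exists M : R, forall x, x \in `[a, b] -> `|f x| <= M.
Proof.
move=> cf.
have : compact (f @` `[a, b]).
  by apply: continuous_compact; [exact: continuous_subspaceT|exact: segment_compact].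
move/compact_bounded => [M [_ HM]]; exists (M + 1) => x xab.
by apply: (HM (M + 1)); [rewrite ltrDl|exists x].
Qed.

Lemma Rintegral_oo_cc a b f : mu.-integrable `[a, b] (EFin \o f) ->
  \int[mu]_(x in D[a, b]) f x = \int[mu]_(x in `[a, b]) f x.
Proof.
move=> fi; rewrite -Rintegral_itv_obnd_cbnd; last first.
  by apply: integrableS fi => //; exact: subset_itv_oc_cc.
rewrite -Rintegral_itv_bndo_bndc //.
by apply: integrableS fi => //; exact: subset_itv_oo_cc.
Qed.

Lemma Rintegral_derive1 a b F : a <= b -> (forall x, derivable F x 1) ->
  continuous (derive1 F) -> \int[mu]_(x in D[a, b]) derive1 F x = F b - F a.
Proof.
rewrite le_eqVlt => /predU1P[<- dF cF|ab dF cF].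
  by rewrite set_itvoo0 Rintegral_set0 subrr.
have cF0 := derivable_continuous dF.
rewrite Rintegral_oo_cc; last first.
  apply: continuous_compact_integrable; first exact: segment_compact.
  exact: continuous_subspaceT.
have dF' : derivable_oo_LRcontinuous F a b.
  split; first by move=> x _; exact: dF.
    exact/cvg_at_right_filter/cF0.
  exact/cvg_at_left_filter/cF0.
by rewrite /Rintegral (continuous_FTC2 ab (continuous_subspaceT cF) dF' (fun x _ => erefl)).
Qed.

Lemma C1c_continuous a b phi : C1c a b phi -> continuous phi.
Proof. by case=> /derivable_continuous. Qed.

Lemma C1c_eq0 a b phi x : C1c a b phi -> x \notin `]a, b[ -> phi x = 0.
Proof.
case=> _ _ _ supp xab; apply: contraNeq xab => phix.
by apply: supp; exact: subset_closure.
Qed.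

Lemma C1c_bounded a b phi : C1c a b phi ->
  exists M, forall x, D[a, b] x -> `|phi x| <= M /\ `|derive1 phi x| <= M.
Proof.
move=> phic; have [_ c1 _ _] := phic.
have [M HM] := continuous_bounded_itv a b (C1c_continuous phic).
have [M' HM'] := continuous_bounded_itv a b c1.
exists (Num.max M M') => x; move/subset_itv_oo_cc => xab.
by rewrite !le_max HM // HM' // orbT.
Qed.

Lemma C1c_derive1_L2 a b phi : C1c a b phi -> L2 a b (derive1 phi).
Proof.
move=> phic; have [_ c1 _ _] := phic; have [M HM] := C1c_bounded phic.
apply: (@L2_bounded _ _ _ _ M) => [|x /HM[]//].
by apply: measurable_funTS; exact: continuous_measurable_fun.
Qed.

Lemma C1c_L2 a b phi : C1c a b phi -> L2 a b phi.
Proof.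
move=> phic; have [M HM] := C1c_bounded phic.
apply: (@L2_bounded _ _ _ _ M) => [|x /HM[]//].
by apply: measurable_funTS; apply: continuous_measurable_fun; exact: C1c_continuous phic.
Qed.

Lemma integrable_mul_C1c a b u phi : L2 a b u -> C1c a b phi ->
  mu.-integrable D[a, b] (EFin \o (u \* phi)) /\
  mu.-integrable D[a, b] (EFin \o (u \* derive1 phi)).
Proof.
move=> Lu phic; have [M HM] := C1c_bounded phic.
split; apply: (@integrable_mulb _ _ _ _ _ M) (L2_integrable Lu) _ _.
- exact: L2_measurable (C1c_L2 phic).
- by move=> x /HM[].
- exact: L2_measurable (C1c_derive1_L2 phic).
- by move=> x /HM[].
Qed.

(** Each integrand is an L^2 function times a bounded one, hence integrable. The extended-real
    identity of the definition thus becomes one between real integrals, where linearity is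
    available. *)
Lemma weak_derivativeP a b u g : L2 a b u ->
  is_weak_derivative a b u g <-> L2 a b g /\
    forall phi, C1c a b phi ->
      \int[mu]_(x in D[a, b]) (u x * derive1 phi x) =
      - \int[mu]_(x in D[a, b]) (g x * phi x).
Proof.
move=> Lu; split=> -[Lg H]; split=> // phi phic; have := H _ phic;
  have [_ iu] := integrable_mul_C1c Lu phic;
  have [ig _] := integrable_mul_C1c Lg phic.
- by rewrite /Rintegral => ->; rewrite fineN.
- have /= e1 := integrable_fin_num (measurable_oo a b) iu.
  have /= e2 := integrable_fin_num (measurable_oo a b) ig.
  by move=> H2; rewrite -(fineK e1) -(fineK e2) -EFinN; congr EFin.
Qed.

Lemma eq_weak_derivative a b u v g h :
  {in D[a, b], u =1 v} -> {in D[a, b], g =1 h} ->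
  is_weak_derivative a b u g -> is_weak_derivative a b v h.
Proof.
move=> uv gh [Lg H]; split; first exact: eq_L2 Lg.
move=> phi phic; under eq_integral do rewrite -uv //.
by under [in RHS]eq_integral do rewrite -gh //; exact: H.
Qed.

Lemma weak_derivativeD a b u v g h : L2 a b u -> L2 a b v ->
  is_weak_derivative a b u g -> is_weak_derivative a b v h ->
  is_weak_derivative a b (u \+ v) (g \+ h).
Proof.
move=> Lu Lv /(weak_derivativeP _ Lu)[Lg Hu] /(weak_derivativeP _ Lv)[Lh Hv].
apply/(weak_derivativeP _ (L2D Lu Lv)); split; first exact: L2D.
move=> phi phic.
have [_ iu] := integrable_mul_C1c Lu phic; have [_ iv] := integrable_mul_C1c Lv phic.
have [ig _] := integrable_mul_C1c Lg phic; have [ih _] := integrable_mul_C1c Lh phic.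
under eq_Rintegral do rewrite /= mulrDl.
under [in RHS]eq_Rintegral do rewrite /= mulrDl.
by rewrite !RintegralD // Hu // Hv // opprD.
Qed.

Lemma weak_derivativeZ a b u g (k : R) : L2 a b u ->
  is_weak_derivative a b u g ->
  is_weak_derivative a b (fun x => k * u x) (fun x => k * g x).
Proof.
move=> Lu /(weak_derivativeP _ Lu)[Lg Hu].
apply/(weak_derivativeP _ (L2Z k Lu)); split; first exact: L2Z.
move=> phi phic.
have [_ iu] := integrable_mul_C1c Lu phic.
have [ig _] := integrable_mul_C1c Lg phic.
under eq_Rintegral do rewrite -mulrA.
under [in RHS]eq_Rintegral do rewrite -mulrA.
by rewrite !RintegralZl // Hu // mulrN.
Qed.

Lemma weak_derivativeB a b u v g h : L2 a b u -> L2 a b v ->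
  is_weak_derivative a b u g -> is_weak_derivative a b v h ->
  is_weak_derivative a b (u \- v) (g \- h).
Proof.
move=> Lu Lv ug vh.
have := weak_derivativeD Lu (L2Z (-1) Lv) ug (weak_derivativeZ (-1) Lv vh).
by apply: eq_weak_derivative => x _ /=; rewrite mulN1r.
Qed.

Lemma L2_0 a b : L2 a b (fun=> 0).
Proof. by apply: (@L2_bounded _ _ _ _ 0) => // x _; rewrite normr0. Qed.

Lemma weak_derivative_0 a b : is_weak_derivative a b (fun=> 0) (fun=> 0).
Proof.
apply/(weak_derivativeP _ (L2_0 a b)); split; first exact: L2_0.
move=> phi _; under eq_Rintegral do rewrite mul0r.
under [in RHS]eq_Rintegral do rewrite mul0r.
by rewrite /Rintegral integral0 oppr0.
Qed.

Lemma weak_derivative_sum a b n (k : 'I_n -> R) (u g : 'I_n -> R -> R) :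
  (forall i, L2 a b (u i)) -> (forall i, is_weak_derivative a b (u i) (g i)) ->
  L2 a b (fun x => \sum_(i < n) k i * u i x) /\
  is_weak_derivative a b (fun x => \sum_(i < n) k i * u i x)
    (fun x => \sum_(i < n) k i * g i x).
Proof.
move=> Lu ug.
suff H (s : seq 'I_n) : L2 a b (fun x => \sum_(i <- s) k i * u i x) /\
  is_weak_derivative a b (fun x => \sum_(i <- s) k i * u i x)
    (fun x => \sum_(i <- s) k i * g i x) by exact: H.
elim: s => [|i s [IH1 IH2]].
  split.
    by apply: (eq_L2 _ (L2_0 a b)) => x _ /=; rewrite big_nil.
  by apply: eq_weak_derivative (weak_derivative_0 a b) => x _ /=;
    rewrite big_nil.
have Li := L2Z (k i) (Lu i).
split.
  by apply: (eq_L2 _ (L2D Li IH1)) => x _ /=; rewrite big_cons.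
apply: eq_weak_derivative (weak_derivativeD Li IH1 (weak_derivativeZ (k i) (Lu i) (ug i)) IH2) => x _ /=;
  by rewrite big_cons.
Qed.

(** Integration by parts: [(phi * psi)'] is continuous and its integral is a difference of two
    boundary values, both 0. *)
Lemma C1c_weak_derivative a b phi : C1c a b phi ->
  is_weak_derivative a b phi (derive1 phi).
Proof.
move=> phic; apply/(weak_derivativeP _ (C1c_L2 phic)).
split=> [|psi psic]; first exact: C1c_derive1_L2.
have [d1 c1 _ _] := phic; have [d2 c2 _ _] := psic.
have [_ i1] := integrable_mul_C1c (C1c_L2 phic) psic.
have [i2 _] := integrable_mul_C1c (C1c_derive1_L2 phic) psic.
apply/eqP; rewrite -subr_eq0 opprK -RintegralD //; apply/eqP.
have [ba|ab] := leP b a; first by rewrite set_itv_ge ?Rintegral_set0 // -leNgt bnd_simp.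
have dE : derive1 (phi * psi) = (fun x => phi x * derive1 psi x + derive1 phi x * psi x).
  apply/funext => x; rewrite derive1E deriveM // -!derive1E addrC /=.
  by rewrite addrC; congr (_ + _); rewrite mulrC.
have dP x : derivable (phi * psi) x 1.
  by apply: derivableM; [exact: d1|exact: d2].
have cP : continuous (derive1 (phi * psi)).
  rewrite dE => x; apply: cvgD; apply: cvgM.
  - exact: (C1c_continuous phic).
  - exact: c2.
  - exact: c1.
  - exact: (C1c_continuous psic).
rewrite -dE (Rintegral_derive1 (ltW ab) dP cP).
rewrite -[(phi * psi) b]/(phi b * psi b) -[(phi * psi) a]/(phi a * psi a).
by rewrite !(C1c_eq0 phic) ?mul0r ?subrr // !in_itv /= ltxx ?andbF.
Qed.

Lemma C1c_Rintegral_derive1 a b phi : C1c a b phi ->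
  \int[mu]_(x in D[a, b]) derive1 phi x = 0.
Proof.
move=> phic; have [d1 c1 _ _] := phic.
have [ba|ab] := leP b a; first by rewrite set_itv_ge ?Rintegral_set0 // -leNgt bnd_simp.
rewrite (Rintegral_derive1 (ltW ab) d1 c1).
by rewrite !(C1c_eq0 phic) ?subrr // !in_itv /= ltxx ?andbF.
Qed.

End WeakDerivative.

(** * Positive parts and smoothed steps *)

Section Pospart.
Context {R : realType}.
Notation mu := (@lebesgue_measure R).
Implicit Types (a b s t x : R) (f g phi : R -> R).

Lemma pospart_ge x : 0 <= x -> pospart x = x.
Proof. by move=> x0; rewrite /pospart; apply/max_idPl. Qed.

Lemma pospart_le x : x <= 0 -> pospart x = 0.
Proof. by move=> x0; rewrite /pospart; apply/max_idPr. Qed.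

Lemma pospart_ge0 x : 0 <= pospart x.
Proof. by rewrite /pospart le_max lexx orbT. Qed.

Lemma pospartE x : pospart x = (x + `|x|) / 2.
Proof.
have [x0|x0] := leP 0 x.
  by rewrite pospart_ge // ger0_norm //; lra.
by rewrite pospart_le ?ltW // ltr0_norm //; lra.
Qed.

Lemma continuous_pospart (k p : R) : continuous (fun x => pospart (k * x - p)).
Proof.
have -> : (fun x => pospart (k * x - p)) =
          (fun x => ((k * x - p) + `|k * x - p|) / 2).
  by apply/funext => x; rewrite pospartE.
have c : continuous (fun x : R => k * x - p).
  by move=> x; apply: cvgB; [apply: cvgM; [exact: cvg_cst|exact: cvg_id]|exact: cvg_cst].
move=> x; apply: cvgM; last exact: cvg_cst.
by apply: cvgD; [exact: c|apply: cvg_norm; exact: c].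
Qed.

(* A uniform second-order expansion: it is stable under linear combinations and
   covers the kinks of the squared positive part without case analysis. *)
Definition quad_expansion f (f' : R -> R) := exists C : R,
  forall x h, `|f (x + h) - f x - f' x * h| <= C * h ^+ 2.

(** After division by [h] the error of the expansion is at most [C * |h|], which tends to 0. *)
Lemma quad_expansion_derive f f' : quad_expansion f f' ->
  (forall x, derivable f x 1) /\ derive1 f = f'.
Proof.
move=> [C HC]; have C1 : 0 < `|C| + 1 by rewrite ltr_wpDl.
have key x : h^-1 *: (f (h + x) - f x) @[h --> 0^'] --> f' x.
  apply/cvgrPdist_le => /= e e0.
  near=> h.
  have h0 : h != 0 by near: h; exact: nbhs_dnbhs_neq.
  have -> : f' x - h^-1 *: (f (h + x) - f x) =
            - (h^-1 * (f (x + h) - f x - f' x * h)).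
    by rewrite /GRing.scale /= (addrC h x); field.
  rewrite normrN normrM normfV ler_pdivrMl ?normr_gt0 //.
  apply: (le_trans (HC x h)).
  rewrite -real_normK ?num_real // expr2 mulrCA ler_wpM2l //.
  have hh : `|h| < e / (`|C| + 1).
    by near: h; apply: dnbhs0_lt; rewrite divr_gt0.
  apply: (@le_trans _ _ ((`|C| + 1) * `|h|)).
    by rewrite ler_wpM2r // ler_wpDr // ler_norm.
  by rewrite mulrC -ler_pdivlMr // ltW.
split=> [x|]; last first.
  apply/funext => x; apply/cvg_lim; [exact: Rhausdorff|exact: key].
apply/cvg_ex; exists (f' x).
(* [derivable] shifts the argument by [h *: 1], the limit above by [h]; the two quotients have to be
   identified before convergence transfers. *)
have /= := key x.
set q1 := (f in f n @[n --> _] --> _ -> _).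
set q2 := (f in _ -> f n @[n --> _] --> _).
suff -> : q1 = q2 by [].
by apply/funext => h; rewrite /q1 /q2 /= [X in _ = _ *: (f (X + _) - _)]mulr1.
Unshelve. all: by end_near. Qed.

Lemma quad_expansionD f f' g g' : quad_expansion f f' -> quad_expansion g g' ->
  quad_expansion (fun x => f x + g x) (fun x => f' x + g' x).
Proof.
move=> [C HC] [D HD]; exists (C + D) => x h.
apply: le_trans (_ : `|f (x + h) - f x - f' x * h| + `|g (x + h) - g x - g' x * h| <= _).
  by apply: le_trans (ler_normD _ _); rewrite le_eqVlt; apply/orP; left; apply/eqP; congr `|_|; ring.
by rewrite mulrDl lerD.
Qed.

Lemma quad_expansionZ k f f' : quad_expansion f f' ->
  quad_expansion (fun x => k * f x) (fun x => k * f' x).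
Proof.
move=> [C HC]; exists (`|k| * C) => x h.
by rewrite -mulrA -mulrBr -mulrBr normrM -mulrA ler_wpM2l.
Qed.

(** The derivative is Lipschitz with constant [2 * k ^ 2], so the remainder is at most
    [k ^ 2 * h ^ 2]; the signs of the two arguments give four polynomial inequalities. *)
Lemma quad_expansion_pospart (k p : R) :
  quad_expansion (fun x => pospart (k * x - p) ^+ 2)
    (fun x => 2 * k * pospart (k * x - p)).
Proof.
exists (k ^+ 2) => x h.
have -> : k * (x + h) - p = (k * x - p) + k * h by ring.
set y := k * x - p; set d := k * h.
have -> : 2 * k * pospart y * h = 2 * pospart y * d by rewrite /d; ring.
have -> : k ^+ 2 * h ^+ 2 = d ^+ 2 by rewrite /d; ring.
rewrite ler_norml; have [y0|y0] := leP 0 y; have [z0|z0] := leP 0 (y + d).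
- by rewrite (pospart_ge y0) (pospart_ge z0); apply/andP; split; nra.
- by rewrite (pospart_ge y0) (pospart_le (ltW z0)); apply/andP; split; nra.
- by rewrite (pospart_ge z0) (pospart_le (ltW y0)); apply/andP; split; nra.
- by rewrite (pospart_le (ltW y0)) (pospart_le (ltW z0)); apply/andP; split; nra.
Qed.

(** A C^1 quadratic spline rising from 0 at [s] to 1 at [s + 2 * e], written as a second difference
    of squared positive parts so that [quad_expansion_pospart] differentiates it; the factors [1]
    match the slope [k] there. *)
Definition step (e s x : R) : R :=
  (pospart (1 * x - s) ^+ 2 - 2 * pospart (1 * x - (s + e)) ^+ 2 +
   pospart (1 * x - (s + 2 * e)) ^+ 2) / (2 * e ^+ 2).

(** The derivative of [step]: a hat of height [1 / e] over [[s, s + 2 * e]] with total mass 1,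
    approximating a Dirac mass at [s]. *)
Definition bump (e s x : R) : R :=
  (pospart (1 * x - s) - 2 * pospart (1 * x - (s + e)) +
   pospart (1 * x - (s + 2 * e))) / e ^+ 2.

Lemma quad_expansion_step e s : 0 < e -> quad_expansion (step e s) (bump e s).
Proof.
move=> e0.
have := quad_expansionZ (2 * e ^+ 2)^-1 (quad_expansionD (quad_expansionD
  (quad_expansion_pospart 1 s)
  (quad_expansionZ (-2) (quad_expansion_pospart 1 (s + e))))
  (quad_expansion_pospart 1 (s + 2 * e))).
congr quad_expansion; apply/funext => x.
  by rewrite /step mulrC; congr (_ * _); ring.
by rewrite /bump; field; rewrite gt_eqF.
Qed.

Lemma step_le e s x : 0 < e -> x <= s -> step e s x = 0.
Proof.
by move=> e0 xs; rewrite /step !pospart_le; [rewrite !(expr0n, mulr0, subr0, addr0, mul0r)|lra..].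
Qed.

Lemma step_ge e s x : 0 < e -> s + 2 * e <= x -> step e s x = 1.
Proof.
by move=> e0 xs; rewrite /step !pospart_ge; [field; rewrite gt_eqF|lra..].
Qed.

Lemma step_bound e s x : 0 < e -> 0 <= step e s x <= 1.
Proof.
move=> e0; have [xs|xs] := leP x s; first by rewrite step_le // lexx ler01.
have [xe|xe] := leP (s + 2 * e) x; first by rewrite step_ge // lexx ler01.
have e2 : 0 < 2 * e ^+ 2 by rewrite mulr_gt0 // exprn_gt0.
rewrite /step (@pospart_le (1 * x - (s + 2 * e))); last lra.
rewrite (@pospart_ge (1 * x - s)); last lra.
suff : 0 <= (1 * x - s) ^+ 2 - 2 * pospart (1 * x - (s + e)) ^+ 2 + 0 ^+ 2 <= 2 * e ^+ 2.
  by move=> /andP[h1 h2]; apply/andP; split; [exact: divr_ge0 h1 (ltW e2)|rewrite ler_pdivrMr // [1 * (2 * _)]mul1r].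
by have [h|h] := leP (1 * x - (s + e)) 0; [rewrite (pospart_le h)|rewrite (pospart_ge (ltW h))]; apply/andP; split; nra.
Qed.

Lemma bump_le e s x : 0 < e -> x <= s -> bump e s x = 0.
Proof.
by move=> e0 xs; rewrite /bump !pospart_le; [rewrite !(mulr0, subr0, addr0, mul0r)|lra..].
Qed.

Lemma bump_ge e s x : 0 < e -> s + 2 * e <= x -> bump e s x = 0.
Proof.
by move=> e0 xs; rewrite /bump !pospart_ge; [field; rewrite gt_eqF|lra..].
Qed.

Lemma bump_bound e s x : 0 < e -> 0 <= bump e s x <= e^-1.
Proof.
move=> e0.
have e2 : 0 < e ^+ 2 by rewrite exprn_gt0.
have -> : e^-1 = e / e ^+ 2 by field; rewrite gt_eqF.
have [xs|xs] := leP x s; first by rewrite bump_le // lexx divr_ge0 ?ltW.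
have [xe|xe] := leP (s + 2 * e) x; first by rewrite bump_ge // lexx divr_ge0 ?ltW.
rewrite /bump (@pospart_le (1 * x - (s + 2 * e))); last lra.
rewrite (@pospart_ge (1 * x - s)); last lra.
suff : 0 <= (1 * x - s) - 2 * pospart (1 * x - (s + e)) + 0 <= e.
  by move=> /andP[h1 h2]; apply/andP; split; [exact: divr_ge0 h1 (ltW e2)|rewrite ler_pM2r // invr_gt0].
by have [h|h] := leP (1 * x - (s + e)) 0; [rewrite (pospart_le h)|rewrite (pospart_ge (ltW h))]; apply/andP; split; lra.
Qed.

Lemma continuous_bump e s : continuous (bump e s).
Proof.
move=> x; apply: cvgM; last exact: cvg_cst.
apply: cvgD; last exact: continuous_pospart.
apply: cvgB; first exact: continuous_pospart.
by apply: cvgM; [exact: cvg_cst|exact: continuous_pospart].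
Qed.

Lemma C1c_supp a b (p q : R) phi : a < p -> q < b ->
  (forall x, derivable phi x 1) -> continuous (derive1 phi) ->
  (forall x, x < p -> phi x = 0) -> (forall x, q < x -> phi x = 0) ->
  C1c a b phi.
Proof.
move=> ap qb dphi cphi lo hi.
have sub : closure [set x | phi x != 0] `<=` `[p, q].
  rewrite [X in _ `<=` X](closure_id _).1; last exact: itv_closed.
  apply: closure_subset => x /= phix; rewrite in_itv /=; apply/andP; split.
    by rewrite leNgt; apply: contraNN phix => /lo ->.
  by rewrite leNgt; apply: contraNN phix => /hi ->.
split => //.
- by apply: subclosed_compact sub; [exact: closed_closure|exact: segment_compact].
- move=> x /sub /=; rewrite !in_itv /= => /andP[px xq].
  by rewrite (lt_le_trans ap px) (le_lt_trans xq qb).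
Qed.

End Pospart.

(** * Representation by a primitive *)

Lemma integrable_EFinB d (T : measurableType d) (R : realType)
    (mu : {measure set T -> \bar R}) (A : set T) (f g : T -> R) : measurable A ->
  mu.-integrable A (EFin \o f) -> mu.-integrable A (EFin \o g) ->
  mu.-integrable A (EFin \o (fun x => f x - g x)).
Proof.
move=> mA fi gi.
rewrite (_ : EFin \o _ = (EFin \o f) \- (EFin \o g))%E //.
exact: integrableB.
Qed.

Lemma integrable_patch d (T : measurableType d) (R : realType)
    (mu : {measure set T -> \bar R}) (A : set T) (f : T -> R) : measurable A ->
  mu.-integrable A (EFin \o f) -> mu.-integrable setT (EFin \o (f \_ A)).
Proof.
by move=> mA fi; rewrite -restrict_EFin; have := (integrable_mkcond _ mA).1 fi.
Qed.

Lemma le_Rintegral_patch d (T : measurableType d) (R : realType)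
    (mu : {measure set T -> \bar R}) (A B : set T) (f g : T -> R) :
  measurable A -> measurable B ->
  mu.-integrable A (EFin \o f) -> mu.-integrable B (EFin \o g) ->
  (forall x, (f \_ A) x <= (g \_ B) x) ->
  (\int[mu]_(x in A) f x <= \int[mu]_(x in B) g x)%R.
Proof.
move=> mA mB fi gi fg; rewrite Rintegral_mkcond [leRHS]Rintegral_mkcond.
by apply: le_Rintegral => //; exact: integrable_patch.
Qed.

Section Representation.
Context {R : realType}.
Notation mu := (@lebesgue_measure R).
Implicit Types (a b s t x : R) (u f g phi : R -> R).

Local Notation "D[ a , b ]" := (`]a, b[%classic : set R).

(** Failure on the whole interval would place a set of measure [q - p > 0] inside a null set. *)
Lemma ae_exists_itv (P : R -> Prop) (p q : R) : p < q ->
  {ae mu, forall x, P x} -> exists2 x, x \in `]p, q[ & P x.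
Proof.
move=> pq [N [mN N0 PN]]; apply: contrapT => H.
have sub : D[p, q] `<=` N.
  by move=> x xpq; apply: PN => Px; apply: H; exists x.
have : (mu D[p, q] <= mu N)%E by apply: le_measure; rewrite ?inE //; exact: measurable_oo.
by rewrite N0 lebesgue_measure_itv /= lte_fin pq -EFinB lee_fin subr_le0 leNgt pq.
Qed.

(** The definition of [lebesgue_pt] averages over a ball of measure [2 * r], so an average below
    [d / 2] gives an integral below [d * r]. *)
Lemma lebesgue_pt_small f x (d : R) : mu.-integrable setT (EFin \o f) ->
  lebesgue_pt f x -> 0 < d -> exists2 r0, 0 < r0 &
  forall r, 0 < r -> r < r0 ->
    \int[mu]_(y in ball x r) `|f y - f x| <= d * r.
Proof.
move=> fi fx d0.
have d2 : 0 < d / 2 by rewrite divr_gt0.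
have : \forall r \near (0:R)^'+, (davg f x r < (d / 2)%:E)%E.
  have /fine_cvgP[finf /cvgr_lt /(_ _ d2) ltf] := fx.
  near=> r; have fr : davg f x r \is a fin_num by near: r.
  by rewrite -(fineK fr) lte_fin; near: r.
move=> /= [r0 /= r00 Hr]; exists r0 => // r rp rr0.
have := Hr r; rewrite /= sub0r normrN gtr0_norm // => /(_ rr0 rp).
rewrite /davg /iavg (lebesgue_measure_ball _ (ltW rp)).
have bfin : (mu (ball x r) < +oo)%E.
  by rewrite (lebesgue_measure_ball _ (ltW rp)) ltry.
have ib : mu.-integrable (ball x r) (EFin \o (fun y => f y - f x)).
  have -> : EFin \o (fun y => f y - f x) = ((EFin \o f) \- (EFin \o cst (f x)))%E.
    by [].
  apply: integrableB; first exact: measurable_ball.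
    by apply: integrableS fi => //; exact: measurable_ball.
  apply: measurable_bounded_integrable; first exact: measurable_ball.
  - exact: bfin.
  - exact: measurable_cst.
  - exact: bounded_cst.
have inorm := integrable_norm ib.
have mB : @measurable _ (measurableTypeR R) (ball x r) by exact: measurable_ball.
have fn := integrable_fin_num mB inorm.
have -> : (\int[mu]_(y in ball x r) `|((center (f x) \o f) y)%:E| =
          (\int[mu]_(y in ball x r) `|f y - f x|)%R%:E)%E.
  by rewrite /Rintegral fineK.
rewrite inver mulrn_eq0 /= gt_eqF // -EFinM lte_fin => /ltW.
rewrite ler_pdivrMl ?mulrn_wgt0 // => /le_trans; apply.
by rewrite mulr2n le_eqVlt; apply/orP; left; apply/eqP; field.
Unshelve. all: by end_near. Qed.

Lemma L2_integrableT a b u : L2 a b u ->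
  mu.-integrable setT (EFin \o (u \_ D[a, b])).
Proof.
move=> /L2_integrable iu.
by have := integrable_patch (measurable_oo a b) iu.
Qed.

Lemma L2_lebesgue_pt a b u : L2 a b u ->
  {ae mu, forall x, lebesgue_pt (u \_ D[a, b]) x}.
Proof.
move=> /L2_integrable iu; apply: lebesgue_differentiation.
by apply: integrable_locally; [exact: measurable_oo|exact: iu].
Qed.

Lemma integrable_dist_ball f x r : mu.-integrable setT (EFin \o f) -> 0 < r ->
  mu.-integrable (ball x r) (EFin \o (fun y => `|f y - f x|)).
Proof.
move=> fi rp.
have mB : @measurable _ (measurableTypeR R) (ball x r) by exact: measurable_ball.
apply: integrable_norm.
have -> : EFin \o (fun y => f y - f x) = ((EFin \o f) \- (EFin \o cst (f x)))%E.
  by [].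
apply: integrableB => //.
  by apply: integrableS fi.
have bfin : (mu (ball x r) < +oo)%E.
  by rewrite (lebesgue_measure_ball _ (ltW rp)) ltry.
apply: measurable_bounded_integrable => //.
exact: bounded_cst.
Qed.

(** Since [bump] has mass 1, [u s] can be moved under the integral. The hat is at most [1 / e] and
    lives in the ball of radius [3 * e], where the Lebesgue point bounds the integral of [|u - u s|]
    by [d / 3 * (3 * e)]. *)
Lemma bump_cvg a b u s (d : R) : L2 a b u -> s \in `]a, b[ ->
  lebesgue_pt (u \_ D[a, b]) s -> 0 < d -> exists2 e0, 0 < e0 &
  forall e, 0 < e -> e < e0 ->
    `|\int[mu]_(x in D[a, b]) (u x * bump e s x) - u s| <= d.
Proof.
move=> Lu sab us d0; have := sab; rewrite in_itv /= => /andP[as_ sb].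
have sD : s \in D[a, b] by rewrite inE.
have d3 : 0 < d / 3 by rewrite divr_gt0.
have [r0 r00 Hr] := lebesgue_pt_small (L2_integrableT Lu) us d3.
(* The first bound keeps the radius [3 * e] below [r0]; the second keeps the support of the hat
   inside the interval, so that its mass there is 1. *)
exists (Num.min (r0 / 3) ((b - s) / 2)) => [|e e0].
  by rewrite lt_min !divr_gt0 // subr_gt0.
rewrite lt_min => /andP[er eb].
have mB : @measurable _ (measurableTypeR R) (ball s (3 * e)) by exact: measurable_ball.
have mD := @measurable_oo R a b.
have [dstep stepE] := quad_expansion_derive (quad_expansion_step s e0).
have cbump := @continuous_bump R e s.
have int1 : \int[mu]_(x in D[a, b]) bump e s x = 1.
  rewrite -stepE Rintegral_derive1 ?stepE //; last by rewrite ltW // (lt_trans as_ sb).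
  by rewrite step_ge ?step_le ?subr0 // ?ltW //; lra.
have mbump : measurable_fun D[a, b] (bump e s).
  by apply: measurable_funTS; exact: continuous_measurable_fun.
have bumpM x : `|bump e s x| <= e^-1.
  by have /andP[h1 h2] := bump_bound s x e0; rewrite ger0_norm.
have i1 := integrable_mulb (L2_integrable Lu) mbump (fun x _ => bumpM x).
have i2 : mu.-integrable D[a, b] (EFin \o (fun x => u s * bump e s x)).
  by apply: integrable_EFinZ => //; apply: integrable_bounded mbump (fun x _ => bumpM x).
have -> : u s = \int[mu]_(x in D[a, b]) (u s * bump e s x).
  rewrite RintegralZl // ?int1 ?mulr1 //.
  exact: integrable_bounded mbump (fun x _ => bumpM x).
rewrite -RintegralB //.
have i3 : mu.-integrable D[a, b]
    (EFin \o (fun x => u x * bump e s x - u s * bump e s x)).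
  by have := integrable_EFinB mD i1 i2.
apply: (le_trans (le_normr_Rintegral mD i3)).
have e3 : 0 < 3 * e by rewrite mulr_gt0.
have ib := integrable_dist_ball s (L2_integrableT Lu) e3.
apply: (@le_trans _ _ (\int[mu]_(y in ball s (3 * e))
    (e^-1 * `|(u \_ D[a, b]) y - (u \_ D[a, b]) s|))).
  apply: le_Rintegral_patch => //.
  - exact: (integrable_norm i3).
  - exact: integrable_EFinZ.
  move=> x; rewrite /patch; case: ifPn => xD; case: ifPn => xB; last by [].
  - rewrite sD -mulrBl normrM mulrC.
    by rewrite ler_wpM2r.
  - suff -> : bump e s x = 0 by rewrite !mulr0 subrr normr0.
    move: xB; rewrite notin_setE /ball /= => /negP; rewrite -leNgt => xB.
    have [xs|xs] := leP x s; first by rewrite bump_le.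
    rewrite bump_ge //; move: xB; rewrite ltr0_norm ?subr_lt0 //; lra.
  - by rewrite mulr_ge0 // invr_ge0 ltW.
rewrite RintegralZl // ler_pdivrMl //.
apply: le_trans (Hr _ e3 _) _; first by move: er; rewrite ltr_pdivlMr // mulrC.
by rewrite le_eqVlt; apply/orP; left; apply/eqP; field.
Qed.

(** [step] differs from the indicator only inside the ball of radius [3 * e], by at most 1. The
    Lebesgue point serves to bound the integral of [|g|] there by [3 * e + 6 * e * c], with [c] the
    value [|g s|]. *)
Lemma step_cvg a b g s (d : R) : L2 a b g -> s \in `]a, b[ ->
  lebesgue_pt (g \_ D[a, b]) s -> 0 < d -> exists2 e0, 0 < e0 &
  forall e, 0 < e -> e < e0 ->
    `|\int[mu]_(x in D[a, b]) (g x * step e s x) -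
      \int[mu]_(x in D[a, b]) (g x * (s < x)%R%:R)| <= d.
Proof.
move=> Lg sab gs d0; have := sab; rewrite in_itv /= => /andP[as_ sb].
have sD : s \in D[a, b] by rewrite inE.
have [r0 r00 Hr] := lebesgue_pt_small (L2_integrableT Lg) gs ltr01.
set c := `|(g \_ D[a, b]) s| in Hr *.
have c1 : 0 < 3 * (1 + 2 * c).
  by rewrite mulr_gt0 // ltr_pwDl // mulr_ge0 // normr_ge0.
exists (Num.min (r0 / 3) (d / (3 * (1 + 2 * c)))) => [|e e0].
  by rewrite lt_min !divr_gt0.
rewrite lt_min => /andP[er ed].
have e3 : 0 < 3 * e by rewrite mulr_gt0.
have mB : @measurable _ (measurableTypeR R) (ball s (3 * e)) by exact: measurable_ball.
have mD := @measurable_oo R a b.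
have cstep : continuous (step e s).
  exact/derivable_continuous/(quad_expansion_derive (quad_expansion_step s e0)).1.
have mstep : measurable_fun D[a, b] (step e s).
  by apply: measurable_funTS; exact: continuous_measurable_fun.
have stepM x : `|step e s x| <= 1.
  by have /andP[h1 h2] := step_bound s x e0; rewrite ger0_norm.
have mind : measurable_fun D[a, b] (fun x : R => (s < x)%R%:R : R).
  have -> : (fun x : R => (s < x)%R%:R : R) = \1_(`]s, +oo[%classic).
    by apply/funext => x; rewrite indicE mem_setE in_itv /= andbT.
  exact: measurable_indic.
have indM x : `|(s < x)%R%:R : R| <= 1.
  by case: (s < x); rewrite ?normr1 ?normr0.
have i1 := integrable_mulb (L2_integrable Lg) mstep (fun x _ => stepM x).
have i2 := integrable_mulb (L2_integrable Lg) mind (fun x _ => indM x).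
rewrite -RintegralB //.
have i3 : mu.-integrable D[a, b]
    (EFin \o (fun x => g x * step e s x - g x * (s < x)%R%:R)).
  by have := integrable_EFinB mD i1 i2.
apply: (le_trans (le_normr_Rintegral mD i3)).
have ib := integrable_dist_ball s (L2_integrableT Lg) e3.
have bfin : mu (ball s (3 * e)) = (3 * e *+ 2)%:E.
  by rewrite (lebesgue_measure_ball _ (ltW e3)).
have ic : mu.-integrable (ball s (3 * e)) (EFin \o cst c).
  apply: measurable_bounded_integrable => //; last exact: bounded_cst.
  by rewrite [X in (X < _)%E]bfin ltry.
apply: (@le_trans _ _ (\int[mu]_(y in ball s (3 * e))
    (`|(g \_ D[a, b]) y - (g \_ D[a, b]) s| + cst c y))).
  apply: le_Rintegral_patch => //.
  - exact: (integrable_norm i3).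
  - exact: integrable_EFinD.
  move=> x; rewrite /patch; case: ifPn => xD; case: ifPn => xB; last by [].
  - apply: (@le_trans _ _ `|g x|).
      rewrite -mulrBr normrM ler_piMr //.
      have /andP[h1 h2] := step_bound s x e0.
      by case: (s < x) => /=; rewrite ler_norml; apply/andP; split; lra.
    rewrite /= /c /patch sD.
    have -> : `|g x| = `|(g x - g s) + g s| by rewrite subrK.
    exact: ler_normD.
  - suff -> : step e s x = (s < x)%R%:R by rewrite subrr normr0.
    move: xB; rewrite notin_setE /ball /= => /negP; rewrite -leNgt => xB.
    have [xs|xs] := leP x s; first by rewrite step_le.
    rewrite step_ge //; move: xB; rewrite ltr0_norm ?subr_lt0 //; lra.
  - by rewrite addr_ge0 //= /c.
have icE : \int[mu]_(y in ball s (3 * e)) cst c y = c * (3 * e *+ 2).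
  by rewrite Rintegral_cst //; congr (_ * _); exact: (congr1 fine bfin).
rewrite RintegralD // icE.
have h1 := Hr _ e3; have {h1} := h1 _; rewrite (_ : 3 * e < r0); last first.
  by move: er; rewrite ltr_pdivlMr // mulrC.
move=> /(_ isT) h1; apply: le_trans (lerD h1 (lexx _)) _.
have h2 : e * (3 * (1 + 2 * c)) <= d by rewrite -ler_pdivlMr // ltW.
by apply: le_trans h2; rewrite le_eqVlt; apply/orP; left; apply/eqP; rewrite mulr2n; ring.
Qed.

Lemma ae_imply (P Q : R -> Prop) : (forall x, P x -> Q x) ->
  {ae mu, forall x, P x} -> {ae mu, forall x, Q x}.
Proof.
by move=> PQ; apply: filterS PQ; exact: (ae_filter_ringOfSetsType mu).
Qed.

Lemma ae_imply2 (P Q S : R -> Prop) : (forall x, P x -> Q x -> S x) ->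
  {ae mu, forall x, P x} -> {ae mu, forall x, Q x} -> {ae mu, forall x, S x}.
Proof.
by move=> PQS; apply: filterS2 PQS; exact: (ae_filter_ringOfSetsType mu).
Qed.

(* The test functions [step e s - step e t] tend to the indicator of [`]s, t]];
   the limit is taken at common Lebesgue points of [u] and [g]. *)
Lemma weak_derivative_increment a b u g s t : L2 a b u ->
  is_weak_derivative a b u g -> s \in `]a, b[ -> t \in `]a, b[ ->
  lebesgue_pt (u \_ D[a, b]) s -> lebesgue_pt (u \_ D[a, b]) t ->
  lebesgue_pt (g \_ D[a, b]) s -> lebesgue_pt (g \_ D[a, b]) t ->
  u s + \int[mu]_(x in D[a, b]) (g x * (s < x)%R%:R) =
  u t + \int[mu]_(x in D[a, b]) (g x * (t < x)%R%:R).
Proof.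
move=> Lu /(weak_derivativeP _ Lu)[Lg ug].
wlog st : s t / s < t => [H sab tab us ut gs gt|].
  have [st|ts|->//] := ltgtP s t; first exact: H.
  by apply/esym; exact: H.
move=> sab tab us ut gs gt.
have := sab; rewrite in_itv /= => /andP[as_ sb].
have := tab; rewrite in_itv /= => /andP[at_ tb].
apply/eqP; rewrite -subr_eq0 -normr_le0; apply/ler_addgt0Pl => d0 d00.
rewrite addr0.
(* Four limits enter the identity, two for [u] and two for [g]; each may err by a quarter. *)
have d4 : 0 < d0 / 4 by rewrite divr_gt0.
have [e1 e1p H1] := bump_cvg Lu sab us d4.
have [e2 e2p H2] := bump_cvg Lu tab ut d4.
have [e3 e3p H3] := step_cvg Lg sab gs d4.
have [e4 e4p H4] := step_cvg Lg tab gt d4.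
(* The last bound keeps [t + 2 * e], the right end of the support, below [b]. *)
pose m := Num.min (Num.min e1 e2) (Num.min (Num.min e3 e4) ((b - t) / 2)).
have mp : 0 < m.
  by rewrite !lt_min e1p e2p e3p e4p /= divr_gt0 // subr_gt0.
pose e := m / 2.
have ep : 0 < e by rewrite divr_gt0.
have : e < m by rewrite /e ltr_pdivrMr //; lra.
rewrite !lt_min => /andP[/andP[l1 l2] /andP[/andP[l3 l4] l5]].
have {}H1 := H1 _ ep l1; have {}H2 := H2 _ ep l2.
have {}H3 := H3 _ ep l3; have {}H4 := H4 _ ep l4.
have qe : quad_expansion (fun x => step e s x + -1 * step e t x)
   (fun x => bump e s x + -1 * bump e t x).
  apply: quad_expansionD; first exact: quad_expansion_step.
  by apply: quad_expansionZ; exact: quad_expansion_step.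
have [dphi phiE] := quad_expansion_derive qe.
have cphi : continuous (fun x => bump e s x + -1 * bump e t x).
  move=> x; apply: cvgD; first exact: continuous_bump.
  by apply: cvgM; [exact: cvg_cst|exact: continuous_bump].
have phic : C1c a b (fun x => step e s x + -1 * step e t x).
  apply: (@C1c_supp _ a b s (t + 2 * e)).
  - exact: as_.
  - by move: l5; rewrite ltr_pdivlMr //; lra.
  - exact: dphi.
  - by rewrite phiE.
  - by move=> x xs; rewrite !step_le ?mulr0 ?addr0 //; lra.
  - by move=> x xs; rewrite !step_ge //; lra.
have := ug _ phic; rewrite phiE.
have mD := @measurable_oo R a b.
have mstep r : measurable_fun D[a, b] (step e r).
  apply: measurable_funTS; apply: continuous_measurable_fun.
  exact/derivable_continuous/(quad_expansion_derive (quad_expansion_step r ep)).1.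
have stepM r x : D[a, b] x -> `|step e r x| <= 1.
  by have /andP[h1 h2] := step_bound r x ep; rewrite ger0_norm.
have mbump r : measurable_fun D[a, b] (bump e r).
  by apply: measurable_funTS; apply: continuous_measurable_fun; exact: continuous_bump.
have bumpM r x : D[a, b] x -> `|bump e r x| <= e^-1.
  by have /andP[h1 h2] := bump_bound r x ep; rewrite ger0_norm.
have iu r := integrable_mulb (L2_integrable Lu) (mbump r) (bumpM r).
have ig r := integrable_mulb (L2_integrable Lg) (mstep r) (stepM r).
have -> : \int[mu]_(x in D[a, b]) (u x * (bump e s x + -1 * bump e t x)) =
   \int[mu]_(x in D[a, b]) (u x * bump e s x) - \int[mu]_(x in D[a, b]) (u x * bump e t x).
  rewrite -RintegralB; [|exact: mD|exact: iu|exact: iu].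
  by apply: eq_Rintegral => x _; ring.
have -> : \int[mu]_(x in D[a, b]) (g x * (step e s x + -1 * step e t x)) =
   \int[mu]_(x in D[a, b]) (g x * step e s x) - \int[mu]_(x in D[a, b]) (g x * step e t x).
  rewrite -RintegralB; [|exact: mD|exact: ig|exact: ig].
  by apply: eq_Rintegral => x _; ring.
move: H1 H2 H3 H4; rewrite !ler_norml => /andP[? ?] /andP[? ?] /andP[? ?] /andP[? ?] ?.
by apply/andP; split; lra.
Qed.

Definition primitive g x : R := \int[mu]_(y in `]-oo, x]) g y.

(** Turns the tail integrals of [weak_derivative_increment] into a primitive: [u] minus the
    primitive of [g] takes the same value at all common Lebesgue points. *)
Lemma primitive_tail a b g s : L2 a b g ->
  \int[mu]_(x in D[a, b]) (g x * (s < x)%R%:R) +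
  primitive (g \_ D[a, b]) s = \int[mu]_(x in D[a, b]) g x.
Proof.
move=> Lg; have ig := L2_integrableT Lg.
have mS : @measurable _ (measurableTypeR R) `]s, +oo[ by exact: measurable_itv.
have mS' : @measurable _ (measurableTypeR R) `]-oo, s] by exact: measurable_itv.
have mT : @measurable _ (measurableTypeR R) setT by [].
have is1 := integrable_patch mS (integrableS mT mS (@subsetT _ _) ig).
have is2 := integrable_patch mS' (integrableS mT mS' (@subsetT _ _) ig).
rewrite /primitive Rintegral_mkcond [X in _ + X]Rintegral_mkcond [RHS]Rintegral_mkcond.
have -> : (fun x => g x * (s < x)%R%:R) \_ D[a, b] = (g \_ D[a, b]) \_ `]s, +oo[.
  apply/funext => x; rewrite /patch !mem_setE !in_itv /= andbT.
  by case: (s < x); rewrite ?mulr1 ?mulr0 ?if_same.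
have <- := RintegralD mT is1 is2.
apply: eq_Rintegral => x _; rewrite /patch !mem_setE !in_itv /= andbT.
by case: (ltP s x) => sx; rewrite ?addr0 ?add0r.
Qed.

Lemma primitive_derivable a b g s : L2 a b g -> lebesgue_pt (g \_ D[a, b]) s ->
  derivable (primitive (g \_ D[a, b])) s 1 /\
  derive1 (primitive (g \_ D[a, b])) s = (g \_ D[a, b]) s.
Proof.
move=> Lg gs.
have ss : s < s + 1 by rewrite ltrDl.
have ig : mu.-integrable `]-oo, (s + 1)] (EFin \o (g \_ D[a, b])).
  have mS : @measurable _ (measurableTypeR R) `]-oo, (s + 1)] by exact: measurable_itv.
  by have := integrableS measurableT mS (@subsetT _ _) (L2_integrableT Lg).
exact: (FTC1_lebesgue_pt ss ig (ltNyr _) gs).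
Qed.

(* Where a nonnegative function vanishes its continuous representative has a
   minimum, so that the derivative, which exists almost everywhere, is 0. *)
Lemma weak_derivative_eq0 a b u g : L2 a b u -> is_weak_derivative a b u g ->
  {ae mu, forall x, x \in `]a, b[ -> 0 <= u x} ->
  {ae mu, forall x, x \in `]a, b[ -> u x = 0 -> g x = 0}.
Proof.
move=> Lu ug u0; have Lg := ug.1.
have good : {ae mu, forall x, (x \in `]a, b[ -> 0 <= u x) /\
    lebesgue_pt (u \_ D[a, b]) x /\ lebesgue_pt (g \_ D[a, b]) x}.
  apply: ae_imply2 u0 (ae_imply2 (fun x => @conj _ _) (L2_lebesgue_pt Lu) (L2_lebesgue_pt Lg)).
  by move=> x.
apply: ae_imply (good) => x [_ [ux gx]] xab u0x.
have [dG GE] := primitive_derivable Lg gx.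
set G := primitive (g \_ D[a, b]) in dG GE.
have gE : (g \_ D[a, b]) x = g x by rewrite /patch mem_set.
(* Among good points [G y - G x = u y - u x], and here [u x = 0], so [G] has a minimum at [x]
   relative to them. *)
have mono y : (y \in `]a, b[ -> 0 <= u y) /\
    lebesgue_pt (u \_ D[a, b]) y /\ lebesgue_pt (g \_ D[a, b]) y ->
    y \in `]a, b[ -> G x <= G y.
  move=> [uy [uyl gyl]] yab.
  have := weak_derivative_increment Lu ug xab yab ux uyl gx gyl.
  have := primitive_tail x Lg; have := primitive_tail y Lg.
  by rewrite u0x add0r; have := uy yab; rewrite -/G; lra.
have cv : h^-1 *: (G (h + x) - G x) @[h --> 0^'] --> g x.
  rewrite -gE -GE /derive1.
  suff : cvg (h^-1 *: (G (h + x) - G x) @[h --> 0^']) by [].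
  have := dG; rewrite /derivable.
  set q1 := (f in cvg (f n @[n --> _]) -> _).
  set q2 := (f in _ -> cvg (f n @[n --> _])).
  suff -> : q1 = q2 by [].
  by apply/funext => h; rewrite /q1 /q2 /= [h *: 1]mulr1.
have := xab; rewrite in_itv /= => /andP[ax xb].
(* A nonzero derivative would make [G] smaller than [G x] on one side of [x], to the right if it is
   negative and to the left if it is positive; good points exist in every interval there. *)
have [gx0|gx0|//] := ltgtP (g x) 0.
- have [r r0 Hr] : exists2 r, 0 < r &
      forall h, h != 0 -> `|h| < r -> h^-1 *: (G (h + x) - G x) < 0.
    have := cvgr_lt _ cv _ gx0; move=> [r /= r0 Hr]; exists r => // h h0 hr.
    by apply: Hr => //=; rewrite sub0r normrN.
  have xr : x < Num.min b (x + r) by rewrite lt_min xb ltrDl.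
  have [y yI Hy] := ae_exists_itv xr good.
  move: yI; rewrite in_itv /= lt_min => /andP[xy /andP[yb yr]].
  have yab : y \in `]a, b[ by rewrite in_itv /= yb (lt_trans ax xy).
  have := mono _ Hy yab.
  have yx : 0 < y - x by rewrite subr_gt0.
  have := Hr (y - x) (lt0r_neq0 yx); rewrite gtr0_norm // subrK.
  move=> H; have {}H := H ltac:(lra).
  move: H; rewrite /GRing.scale /= pmulr_rlt0 ?invr_gt0 //; lra.
- have [r r0 Hr] : exists2 r, 0 < r &
      forall h, h != 0 -> `|h| < r -> 0 < h^-1 *: (G (h + x) - G x).
    have := cvgr_gt _ cv _ gx0; move=> [r /= r0 Hr]; exists r => // h h0 hr.
    by apply: Hr => //=; rewrite sub0r normrN.
  have xr : Num.max a (x - r) < x by rewrite gt_max ax ltrBlDr ltrDl.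
  have [y yI Hy] := ae_exists_itv xr good.
  move: yI; rewrite in_itv /= gt_max => /andP[/andP[ay yr] yx].
  have yab : y \in `]a, b[ by rewrite in_itv /= ay (lt_trans yx xb).
  have := mono _ Hy yab.
  have yx' : y - x < 0 by rewrite subr_lt0.
  have := Hr (y - x) (ltr0_neq0 yx'); rewrite ltr0_norm // subrK.
  move=> H; have {}H := H ltac:(lra).
  move: H; rewrite /GRing.scale /= nmulr_rgt0 ?invr_lt0 //; lra.
Qed.

(** The zero function [u \- u] has weak derivative [g \- h], so [weak_derivative_eq0] applies to it
    at almost every point. *)
Lemma weak_derivative_unique a b u g h : L2 a b u ->
  is_weak_derivative a b u g -> is_weak_derivative a b u h ->
  {ae mu, forall x, x \in `]a, b[ -> g x = h x}.
Proof.
move=> Lu ug uh.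
have := weak_derivativeB Lu Lu ug uh.
have Lz : L2 a b (u \- u) by apply: (eq_L2 _ (L2_0 a b)) => x _ /=; rewrite subrr.
move=> /(weak_derivative_eq0 Lz) H.
have {H}: {ae mu, forall x, x \in `]a, b[ -> (u \- u) x = 0 -> (g \- h) x = 0}.
  by apply: H; apply: aeW => x _ /=; rewrite subrr.
by apply: ae_imply => x H xab; apply/eqP; rewrite -subr_eq0; apply/eqP/(H xab); rewrite /= subrr.
Qed.

End Representation.

(** * Piecewise linear functions and [H^1_0] *)

Section Hats.
Context {R : realType}.
Notation mu := (@lebesgue_measure R).
Implicit Types (a b s t x p q r k : R) (u f g h w phi : R -> R).

Local Notation "D[ a , b ]" := (`]a, b[%classic : set R).

Lemma continuous_L2 a b f : continuous f -> L2 a b f.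
Proof.
move=> cf; have [M HM] := continuous_bounded_itv a b cf.
apply: (@L2_bounded _ _ _ _ M); last by move=> x /subset_itv_oo_cc /HM.
by apply: measurable_funTS; exact: continuous_measurable_fun.
Qed.

Lemma measurable_gtZ (A : set R) k p : measurable_fun A (fun x => (p < k * x)%R%:R : R).
Proof.
apply: measurable_funTS.
have -> : (fun x => (p < k * x)%R%:R : R) =
    (\1_(`]p, +oo[%classic) : R -> R) \o (fun x => k * x).
  by apply/funext => x /=; rewrite indicE mem_setE in_itv /= andbT.
apply: measurableT_comp; last exact: mulrl_measurable.
exact: measurable_indic.
Qed.

(** The function [F = (k * x - p) * phi] is C^1, and both integrals together are the integral of
    [F'] over the part of the interval where [p < k * x]. At an end of that part either [phi] or the
    linear factor vanishes. *)
Lemma weak_derivative_pospart a b k p : k = 1 \/ k = -1 ->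
  is_weak_derivative a b (fun x => pospart (k * x - p))
    (fun x => k * (p < k * x)%R%:R).
Proof.
move=> k1; have k2 : `|k| = 1 by case: k1 => ->; rewrite ?normrN normr1.
have Lu := continuous_L2 a b (@continuous_pospart R k p).
have Lg : L2 a b (fun x => k * (p < k * x)%R%:R).
  apply: L2Z; apply: (@L2_bounded _ _ _ _ 1); first exact: measurable_gtZ.
  by move=> x _; case: (p < _); rewrite ?normr1 ?normr0.
apply/(weak_derivativeP _ Lu); split=> // phi phic.
have [_ iu] := integrable_mul_C1c Lu phic; have [ig _] := integrable_mul_C1c Lg phic.
apply/eqP; rewrite -subr_eq0 opprK -RintegralD //.
have [ba|ab] := leP b a; first by rewrite set_itv_ge ?Rintegral_set0 // -leNgt bnd_simp.
have [d1 c1 _ _] := phic.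
pose F x := (k * x - p) * phi x.
have [da daE] : (forall x, derivable (fun x => k * x - p) x 1) /\
    derive1 (fun x => k * x - p) = fun=> k.
  apply: quad_expansion_derive; exists 0 => x h; rewrite mul0r.
  by rewrite (_ : _ - _ = 0) ?normr0 //; ring.
have dF x : derivable F x 1 by apply: derivableM; [exact: da|exact: d1].
have FE : derive1 F = fun x => (k * x - p) * derive1 phi x + k * phi x.
  apply/funext => x; rewrite derive1E deriveM; [|exact: da|exact: d1].
  by rewrite -!derive1E daE /GRing.scale /= [phi x * k]mulrC.
have cF : continuous (derive1 F).
  rewrite FE => x; apply: cvgD; apply: cvgM.
  - by apply: cvgB; [apply: cvgM; [exact: cvg_cst|exact: cvg_id]|exact: cvg_cst].
  - exact: c1.
  - exact: cvg_cst.
  - exact: (C1c_continuous phic).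
(* The kink is clamped to [[a, b]], which also covers a kink outside the interval; for [k = -1] the
   positive side is on the left. *)
have [q1 [q2 [[aq1 q12 q2b] [F1 F2] supp]]] : exists q1 q2,
    [/\ [/\ a <= q1, q1 <= q2 & q2 <= b], F q1 = 0 /\ F q2 = 0 &
    forall x, x \in `]a, b[ -> (x \in `]q1, q2[) = (p < k * x)].
  have Fa : F a = 0 by rewrite /F (C1c_eq0 phic) ?mulr0 // in_itv /= ltxx.
  have Fb : F b = 0 by rewrite /F (C1c_eq0 phic) ?mulr0 // in_itv /= ltxx andbF.
  case: k1 => kE.
    exists (Num.min b (Num.max a p)), b; split; first split => //.
    - by rewrite le_min (ltW ab) le_max lexx.
    - by rewrite ge_min lexx.
    - split=> //; rewrite /Num.min /Num.max; case: ifP => // _.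
      by case: ifP => // _; rewrite /F kE mul1r subrr mul0r.
    - move=> x; rewrite !in_itv /= => /andP[ax xb].
      by rewrite gt_min gt_max xb ax (ltNge b) (ltW xb) kE mul1r andbT.
  exists a, (Num.min b (Num.max a (- p))); split; first split => //.
  - by rewrite le_min (ltW ab) le_max lexx.
  - by rewrite ge_min lexx.
  - split=> //; rewrite /Num.min /Num.max; case: ifP => // _.
    by case: ifP => // _; rewrite /F kE mulrN mulN1r opprK subrr mul0r.
  - move=> x; rewrite !in_itv /= => /andP[ax xb].
    by rewrite lt_min lt_max xb ax ltNge (ltW ax) kE mulN1r /= ltrNr.
have iF : mu.-integrable D[q1, q2] (EFin \o derive1 F).
  have [M HM] := continuous_bounded_itv q1 q2 cF.
  apply: (@integrable_bounded _ _ _ _ M); last by move=> x /subset_itv_oo_cc /HM.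
  by apply: measurable_funTS; exact: continuous_measurable_fun.
apply/eqP; transitivity (\int[mu]_(x in D[q1, q2]) derive1 F x); last first.
  by rewrite (Rintegral_derive1 q12 dF cF) F1 F2 subrr.
rewrite Rintegral_mkcond [RHS]Rintegral_mkcond; apply: eq_Rintegral => x _.
rewrite /patch !mem_setE FE; case: (boolP (x \in `]a, b[)) => xab.
  rewrite supp //; case: ifPn => [px|px] /=.
    by rewrite pospart_ge ?mulr1 // subr_ge0 ltW.
  by rewrite mulr0 mul0r addr0 pospart_le ?mul0r // subr_le0 leNgt.
case: ifPn => // xq; case/negP: xab; move: xq; rewrite !in_itv /= => /andP[h1 h2].
by rewrite (le_lt_trans aq1 h1) (lt_le_trans h2 q2b).
Qed.

Lemma weak_derivative_spec a b u : H1 a b u ->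
  is_weak_derivative a b u (weak_derivative a b u).
Proof.
by move=> [_ ex]; rewrite /weak_derivative; case: xgetP => [g _ //|]; case: ex => g /[swap] /[apply].
Qed.

Lemma Rintegral_cst_oo a b (c : R) : a <= b ->
  \int[mu]_(x in D[a, b]) cst c x = c * (b - a).
Proof.
move=> ab; have mE : mu D[a, b] = (b - a)%:E.
  rewrite lebesgue_measure_itv /= lte_fin; case: ltP => // ba.
  by rewrite (@le_anti _ _ a b) ?subrr // ab ba.
rewrite Rintegral_cst; last exact: measurable_oo.
by congr (_ * _); exact: (congr1 fine mE).
Qed.

(** Subtracting the derivative of a nearby test function does not change the integral and leaves an
    [h] of L^2 norm below [d]. Then [|h| <= h ^ 2 / (2 * d) + d / 2] bounds the integral by a
    multiple of [d]. *)
Lemma H10_Rintegral a b w g : H10 a b w -> is_weak_derivative a b w g ->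
  \int[mu]_(x in D[a, b]) g x = 0.
Proof.
move=> [[Lw _] wc] wg; have Lg := wg.1; have mD := @measurable_oo R a b.
have [ba|ab] := leP b a; first by rewrite set_itv_ge ?Rintegral_set0 // -leNgt bnd_simp.
apply/eqP; rewrite -normr_le0; apply/ler_addgt0Pl => e e0; rewrite addr0.
have K0 : 0 < 1 + (b - a) by lra.
have d0 : 0 < e / (1 + (b - a)) by rewrite divr_gt0.
(* The final bound is [d / 2 + d / 2 * (b - a)], which is half of [e]. *)
set d := e / (1 + (b - a)) in d0.
have [phi phic] := wc _ d0.
have Lphi := C1c_L2 phic.
have Lwp : L2 a b (w \- phi).
  by apply: (eq_L2 _ (L2D Lw (L2Z (-1) Lphi))) => x _ /=; rewrite mulN1r.
have wp := weak_derivativeB Lw Lphi wg (C1c_weak_derivative phic).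
have H1wp : H1 a b (w \- phi) by split => //; exists (g \- derive1 phi).
have whE := weak_derivative_spec H1wp.
set h := weak_derivative a b (w \- phi) in whE.
have Lh := whE.1.
rewrite /H1norm -/h !L2normE // -EFinD lte_fin => le.
have {}le : Num.sqrt (\int[mu]_(x in D[a, b]) (h x ^+ 2)) < d.
  by apply: le_lt_trans le; rewrite lerDr sqrtr_ge0.
have I0 : 0 <= \int[mu]_(x in D[a, b]) (h x ^+ 2).
  by apply: Rintegral_ge0 => x _; exact: sqr_ge0.
have {}le : \int[mu]_(x in D[a, b]) (h x ^+ 2) <= d ^+ 2.
  rewrite -[leLHS]sqr_sqrtr //; apply: lerXn2r; rewrite ?nnegrE ?sqrtr_ge0 //; exact: ltW.
have Lphi' := C1c_derive1_L2 phic.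
(* [g \- derive1 phi] and the chosen representative [h] are weak derivatives of the same function,
   hence equal almost everywhere. *)
have -> : \int[mu]_(x in D[a, b]) g x = \int[mu]_(x in D[a, b]) h x.
  transitivity (\int[mu]_(x in D[a, b]) (g x - derive1 phi x)).
    rewrite RintegralB //; [|exact: L2_integrable|exact: L2_integrable].
    by rewrite (C1c_Rintegral_derive1 phic) subr0.
  rewrite /Rintegral; congr fine; apply: ae_eq_integral => //.
  - by apply/measurable_EFinP; exact: L2_measurable wp.1.
  - by apply/measurable_EFinP; exact: L2_measurable Lh.
  - apply: ae_imply (weak_derivative_unique Lwp wp whE) => x H Dx.
    by rewrite -(H Dx).
have ih := L2_integrable Lh.
apply: le_trans (le_normr_Rintegral mD ih) _.
have ic : mu.-integrable D[a, b] (EFin \o cst (d / 2)).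
  by apply: (@integrable_bounded _ _ _ _ `|d / 2|) => //.
have i2 := integrable_EFinZ (d^-1 / 2) mD (L2_sqr_integrable Lh).
apply: (@le_trans _ _ (\int[mu]_(x in D[a, b]) ((d^-1 / 2) * h x ^+ 2 + cst (d / 2) x))).
  apply: le_Rintegral => //.
  - exact: integrable_norm ih.
  - exact: integrable_EFinD.
  move=> x _ /=; rewrite -real_normK ?num_real //.
  have -> : d^-1 / 2 * `|h x| ^+ 2 + d / 2 = `|h x| + (`|h x| - d) ^+ 2 / (2 * d).
    by field; rewrite gt_eqF.
  by rewrite lerDl divr_ge0 ?sqr_ge0 // mulr_ge0 // ltW.
rewrite RintegralD // RintegralZl //; last exact: L2_sqr_integrable.
rewrite (Rintegral_cst_oo _ (ltW ab)).
have h1 : d^-1 / 2 * \int[mu]_(x in D[a, b]) h x ^+ 2 <= d / 2.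
  apply: (@le_trans _ _ (d^-1 / 2 * d ^+ 2)).
    by rewrite ler_wpM2l // divr_ge0 // invr_ge0 ltW.
  by rewrite le_eqVlt; apply/orP; left; apply/eqP; field; rewrite gt_eqF.
have h2 : d * (1 + (b - a)) = e by rewrite /d; field; rewrite gt_eqF.
nra.
Qed.

End Hats.

Lemma Rintegral_sum d (T : measurableType d) (R : realType)
    (mu : {measure set T -> \bar R}) (A : set T) (I : Type) (l : seq I)
    (F : I -> T -> R) : measurable A ->
  (forall i, mu.-integrable A (EFin \o F i)) ->
  mu.-integrable A (EFin \o (fun x => \sum_(i <- l) F i x)) /\
  (\int[mu]_(x in A) \sum_(i <- l) F i x = \sum_(i <- l) \int[mu]_(x in A) F i x)%R.
Proof.
move=> mA iF; elim: l => [|i l [IH1 IH2]].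
  split.
    apply: eq_integrable (integrable0 _ _) => // x _ /=; by rewrite big_nil.
  rewrite big_nil; under eq_Rintegral do rewrite big_nil.
  by rewrite /Rintegral integral0.
split.
  have := integrable_EFinD mA (iF i) IH1.
  by apply: eq_integrable => // x _ /=; rewrite big_cons.
under eq_Rintegral do rewrite big_cons.
by rewrite RintegralD // IH2 big_cons.
Qed.

(** * Smoothing of kinks, and compactly supported piecewise linear functions *)

Section PiecewiseLinear.
Context {R : realType}.
Notation mu := (@lebesgue_measure R).
Implicit Types (a b e s t x p q r k : R) (u f g h w phi : R -> R).

Local Notation "D[ a , b ]" := (`]a, b[%classic : set R).

(** For [k = -1] the condition describes the interval from [- q] to [- p]. The last clause says that
    this reflection respects symmetric bounds, so one computation on []-b, b[] serves both
    orientations. *)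
Lemma itv_indicE k p q : k = 1 \/ k = -1 -> exists p' q',
  [/\ q' - p' = q - p, forall x, (p < k * x < q) = (x \in `]p', q'[) &
      forall b, - b <= p -> q <= b -> - b <= p' /\ q' <= b].
Proof.
case=> ->.
  by exists p, q; split => // x; rewrite in_itv /= mul1r.
exists (- q), (- p); split => [|x|b pb qb].
- by rewrite opprK addrC.
- by rewrite in_itv /= mulN1r andbC ltrNl ltrNr.
- by rewrite lerN2 lerNl.
Qed.

Lemma measurable_itv_indic (A : set R) k p q : k = 1 \/ k = -1 ->
  measurable_fun A (fun x => (p < k * x < q)%R%:R : R).
Proof.
move=> k1; apply: measurable_funTS.
have [p' [q' [_ E _]]] := itv_indicE p q k1.
have -> : (fun x => (p < k * x < q)%R%:R : R) = \1_(`]p', q'[%classic).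
  by apply/funext => x; rewrite indicE mem_setE E.
exact: measurable_indic.
Qed.

Lemma Rintegral_itv_indic b k p q : k = 1 \/ k = -1 ->
  - b <= p -> p <= q -> q <= b ->
  \int[mu]_(x in D[- b, b]) (p < k * x < q)%R%:R = q - p.
Proof.
move=> k1 bp pq qb; have [p' [q' [len E /(_ _ bp qb)[bp' qb']]]] := itv_indicE p q k1.
have pq' : p' <= q' by rewrite -subr_ge0 len subr_ge0.
rewrite -len -[RHS]mul1r -Rintegral_cst_oo // Rintegral_mkcond [RHS]Rintegral_mkcond.
apply: eq_Rintegral => x _; rewrite /patch !mem_setE E.
case: ifPn => xb; case: ifPn => xp //.
case/negP: xb; move: xp; rewrite !in_itv /= => /andP[h1 h2].
by rewrite (le_lt_trans bp' h1) (lt_le_trans h2 qb').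
Qed.

Lemma L2norm_ae a b f h : L2 a b f -> L2 a b h ->
  {ae mu, forall x, x \in `]a, b[ -> f x = h x} -> L2norm a b f = L2norm a b h.
Proof.
move=> Lf Lh fh; rewrite !L2normE // /Rintegral; congr (Num.sqrt (fine _))%:E.
apply: ae_eq_integral => //.
- by apply/measurable_EFinP/measurable_funX; exact: L2_measurable.
- by apply/measurable_EFinP/measurable_funX; exact: L2_measurable.
- by apply: ae_imply fh => x H Dx; rewrite (H Dx).
Qed.

(** A C^1 smoothing of [pospart (k * x - s)], quadratic while [k * x] runs from [s] to [s + e]. Past
    the transition it is lower by [e / 2] for every [s], so this offset cancels in combinations
    whose coefficients sum to 0. *)
Definition mollified e k s x : R :=
  (pospart (k * x - s) ^+ 2 - pospart (k * x - (s + e)) ^+ 2) / (2 * e).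

Definition ramp e k s x : R :=
  (pospart (k * x - s) - pospart (k * x - (s + e))) / e.

Lemma quad_expansion_mollified e k s : 0 < e ->
  quad_expansion (mollified e k s) (fun x => k * ramp e k s x).
Proof.
move=> e0; have := quad_expansionZ (2 * e)^-1 (quad_expansionD
  (quad_expansion_pospart k s)
  (quad_expansionZ (-1) (quad_expansion_pospart k (s + e)))).
congr quad_expansion; apply/funext => x.
  by rewrite /mollified mulrC; congr (_ * _); ring.
by rewrite /ramp; field; rewrite gt_eqF.
Qed.

Lemma quad_expansion_sum n (c : 'I_n -> R) (F G : 'I_n -> R -> R) :
  (forall i, quad_expansion (F i) (G i)) ->
  quad_expansion (fun x => \sum_(i < n) c i * F i x) (fun x => \sum_(i < n) c i * G i x).
Proof.
move=> FG.
suff H (l : seq 'I_n) : quad_expansion (fun x => \sum_(i <- l) c i * F i x)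
    (fun x => \sum_(i <- l) c i * G i x) by exact: H.
elim: l => [|i l IH].
  by exists 0 => x h; rewrite !big_nil mul0r !subr0 mul0r normr0.
have := quad_expansionD (quad_expansionZ (c i) (FG i)) IH.
by congr quad_expansion; apply/funext => x; rewrite big_cons.
Qed.

Lemma mollified_le e k s x : 0 < e -> k * x <= s -> mollified e k s x = 0.
Proof.
by move=> e0 xs; rewrite /mollified !pospart_le;
  [rewrite expr0n subrr mul0r|lra|lra].
Qed.

Lemma mollified_ge e k s x : 0 < e -> s + e <= k * x ->
  mollified e k s x = k * x - s - e / 2.
Proof.
by move=> e0 xs; rewrite /mollified !pospart_ge; [field; rewrite gt_eqF|lra|lra].
Qed.

Lemma mollified_dist e k s x : 0 < e ->
  `|pospart (k * x - s) - mollified e k s x| <= e.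
Proof.
move=> e0; have [xs|xs] := leP (k * x) s.
  by rewrite mollified_le // pospart_le ?subr_le0 // subrr normr0 ltW.
have [xe|xe] := leP (s + e) (k * x).
  rewrite mollified_ge // pospart_ge; last lra.
  by rewrite ger0_norm; lra.
rewrite /mollified (_ : pospart (k * x - (s + e)) = 0); last by apply: pospart_le; lra.
rewrite (_ : pospart (k * x - s) = k * x - s); last by apply: pospart_ge; lra.
set y := k * x - s; rewrite expr0n subr0.
have y0 : 0 < y < e by rewrite /y; apply/andP; split; lra.
case/andP: y0 => y0 ye.
have -> : y - y ^+ 2 / (2 * e) = y * (2 * e - y) / (2 * e).
  by field; rewrite gt_eqF.
have e2 : 0 < 2 * e by rewrite mulr_gt0.
rewrite ger0_norm ?divr_ge0 ?mulr_ge0 ?(ltW y0) ?(ltW e2) //; try lra.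
by rewrite ler_pdivrMr //; nra.
Qed.

(** The slopes are not uniformly close, but the error is at most 1 and confined to a window of
    length [e], hence small in L^2. *)
Lemma ramp_dist e k s x : 0 < e ->
  `|(s < k * x)%R%:R - ramp e k s x| <= (s < k * x < s + e)%R%:R.
Proof.
move=> e0; rewrite /ramp; have [xs|xs] := leP (k * x) s.
  by rewrite !pospart_le; [rewrite /= !subrr mul0r subrr normr0|lra|lra].
have [xe|xe] := leP (s + e) (k * x).
  rewrite !pospart_ge; [|lra|lra].
  by rewrite /= (_ : _ - _ = 0) ?normr0 //; field; rewrite gt_eqF.
rewrite /= (_ : pospart (k * x - (s + e)) = 0); last by apply: pospart_le; lra.
rewrite (_ : pospart (k * x - s) = k * x - s); last by apply: pospart_ge; lra.
set y := k * x - s; rewrite subr0.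
have -> : 1 - y / e = (e - y) / e by field; rewrite gt_eqF.
rewrite ger0_norm ?divr_ge0 ?(ltW e0) //; last by rewrite /y; lra.
by rewrite ler_pdivrMr // /y; lra.
Qed.

Lemma continuous_sum n (c : 'I_n -> R) (F : 'I_n -> R -> R) :
  (forall i, continuous (F i)) -> continuous (fun x => \sum_(i < n) c i * F i x).
Proof.
move=> cF.
suff H (l : seq 'I_n) : continuous (fun x => \sum_(i <- l) c i * F i x) by exact: H.
elim: l => [|i l IH].
  by under [fun x => _]eq_fun do rewrite big_nil; move=> x; exact: cvg_cst.
under [fun x => _]eq_fun do rewrite big_cons.
move=> x; apply: cvgD; last exact: IH.
by apply: cvgM; [exact: cvg_cst|exact: cF].
Qed.

Lemma piecewise_linear_weak_derivative a b n k (c P : 'I_n -> R) :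
  k = 1 \/ k = -1 ->
  L2 a b (fun x => \sum_(i < n) c i * pospart (k * x - P i)) /\
  is_weak_derivative a b (fun x => \sum_(i < n) c i * pospart (k * x - P i))
    (fun x => \sum_(i < n) c i * (k * (P i < k * x)%R%:R)).
Proof.
move=> k1; apply: weak_derivative_sum => i.
  exact/continuous_L2/continuous_pospart.
exact: weak_derivative_pospart.
Qed.

Lemma L2norm_le a b f (d : R) : L2 a b f -> 0 <= d ->
  \int[mu]_(x in D[a, b]) (f x ^+ 2) <= d ^+ 2 -> (L2norm a b f <= d%:E)%E.
Proof.
move=> Lf d0 le; rewrite L2normE // lee_fin.
by rewrite -(ger0_norm d0) -sqrtr_sqr; exact: ler_wsqrtr.
Qed.

Lemma sum_norm_le n (c y : 'I_n -> R) (M : R) : (forall i, `|y i| <= M) ->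
  `|\sum_(i < n) c i * y i| <= (\sum_(i < n) `|c i|) * M.
Proof.
move=> yM; apply: le_trans (ler_norm_sum _ _ _) _; rewrite mulr_suml.
by apply: ler_sum => i _; rewrite normrM ler_wpM2l.
Qed.

(** The two moment conditions say that the sum vanishes beyond its last kink. Replacing each
    positive part by [mollified] preserves this, so the smoothed sum is a test function, and it
    approximates the original in H^1. *)
Lemma piecewise_linear_H10 b n k (c P : 'I_n -> R) p r : k = 1 \/ k = -1 ->
  - b < p -> p <= r -> r < b -> (forall i, p <= P i <= r) ->
  \sum_(i < n) c i = 0 -> \sum_(i < n) c i * P i = 0 ->
  H10 (- b) b (fun x => \sum_(i < n) c i * pospart (k * x - P i)).
Proof.
move=> k1 bp pr rb Ppr c0 cP0.
have [Lw wg] := piecewise_linear_weak_derivative (- b) b c P k1.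
set w := fun x => _ in Lw wg *; set g := (fun x => \sum_(i < n) _) in wg.
split; first by split => //; exists g.
move=> eps eps0.
have bb : - b < b by lra.
have mD := @measurable_oo R (- b) b.
set C := \sum_(i < n) `|c i|.
have C0 : 0 <= C by apply: sumr_ge0 => i _; exact: normr_ge0.
(* The squared norms of the error and of its derivative are at most [2 * b * C ^ 2 * e], using
   [e <= 1], and [C ^ 2 * e]. Both are below [T * e], which the choice of [e] keeps below
   [(eps / 3) ^ 2]. *)
pose T := C ^+ 2 * (2 * b + 1) + 1.
have T0 : 0 < T by rewrite ltr_wpDl // mulr_ge0 ?sqr_ge0 //; lra.
pose e := Num.min (Num.min 1 ((b - r) / 2)) (eps ^+ 2 / (9 * T)).
have e0 : 0 < e.
  by rewrite !lt_min ltr01 /= !divr_gt0 ?exprn_gt0 ?mulr_gt0 // subr_gt0.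
have [e1 eb eT] : [/\ e <= 1, e <= (b - r) / 2 & e <= eps ^+ 2 / (9 * T)].
  by split; rewrite !ge_min lexx ?orbT.
have re : r + e < b by lra.
pose phi x := \sum_(i < n) c i * mollified e k (P i) x.
pose dphi x := \sum_(i < n) c i * (k * ramp e k (P i) x).
have [dphiP phiE] : (forall x, derivable phi x 1) /\ derive1 phi = dphi.
  by apply: quad_expansion_derive; apply: quad_expansion_sum => i; exact: quad_expansion_mollified.
have cdphi : continuous dphi.
  apply: continuous_sum => i x; apply: cvgM; first exact: cvg_cst.
  apply: cvgM; last exact: cvg_cst.
  by apply: cvgB; exact: continuous_pospart.
have philo x : k * x < p -> phi x = 0.
  move=> xp; apply: big1 => i _; have /andP[h1 h2] := Ppr i.
  by rewrite mollified_le ?mulr0 //; lra.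
have phihi x : r + e < k * x -> phi x = 0.
  move=> xp; rewrite /phi.
  transitivity (\sum_(i < n) (c i * (k * x - e / 2) - c i * P i)).
    apply: eq_bigr => i _; have /andP[h1 h2] := Ppr i.
    by rewrite mollified_ge //; [ring|lra].
  by rewrite sumrB -mulr_suml c0 cP0 mul0r subrr.
have phic : C1c (- b) b phi.
  case: k1 => kE.
    apply: (@C1c_supp _ _ _ p (r + e)).
    - exact: bp.
    - exact: re.
    - exact: dphiP.
    - by rewrite phiE.
    - by move=> x xp; apply: philo; rewrite kE mul1r.
    - by move=> x xp; apply: phihi; rewrite kE mul1r.
  apply: (@C1c_supp _ _ _ (- (r + e)) (- p)).
  - by rewrite ltrN2.
  - by rewrite ltrNl.
  - exact: dphiP.
  - by rewrite phiE.
  - by move=> x xp; apply: phihi; rewrite kE mulN1r ltrNr.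
  - by move=> x xp; apply: philo; rewrite kE mulN1r ltrNl.
exists phi => //.
have Lphi := C1c_L2 phic.
have Lwp : L2 (- b) b (w \- phi).
  by apply: (eq_L2 _ (L2D Lw (L2Z (-1) Lphi))) => x _ /=; rewrite mulN1r.
have := weak_derivativeB Lw Lphi wg (C1c_weak_derivative phic); rewrite phiE => wp.
have H1wp : H1 (- b) b (w \- phi) by split => //; exists (g \- dphi).
have whE := weak_derivative_spec H1wp.
(* [H1norm] refers to the chosen representative; almost everywhere uniqueness replaces it by the
   explicit [g \- dphi]. *)
rewrite /H1norm (L2norm_ae whE.1 wp.1 (weak_derivative_unique Lwp whE wp)).
have Te : T * e <= (eps / 3) ^+ 2.
  have := eT; rewrite ler_pdivlMr ?mulr_gt0 // => h.
  have -> : (eps / 3) ^+ 2 = eps ^+ 2 / 9 by field.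
  by rewrite ler_pdivlMr //; lra.
have eps3 : 0 <= eps / 3 by rewrite ltW // divr_gt0.
have n1 : (L2norm (- b) b (w \- phi)%R <= (eps / 3)%:E)%E.
  apply: L2norm_le => //; apply: le_trans Te.
  apply: (@le_trans _ _ (\int[mu]_(x in D[- b, b]) cst (C ^+ 2 * e) x)).
    apply: le_Rintegral => //.
    - exact: L2_sqr_integrable.
    - apply: (@integrable_bounded _ _ _ _ (`|C ^+ 2 * e|)) => //.
    - move=> x _ /=; rewrite /w /phi -sumrB.
      under eq_bigr do rewrite -mulrBr.
      have h := sum_norm_le c (fun i => mollified_dist k (P i) x e0).
      rewrite -real_normK ?num_real //.
      apply: (@le_trans _ _ ((C * e) ^+ 2)).
        by apply: lerXn2r; rewrite ?nnegrE // mulr_ge0 // ltW.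
      rewrite exprMn ler_wpM2l ?sqr_ge0 //; nra.
  rewrite (Rintegral_cst_oo _ (ltW bb)) /T.
  have : 0 <= C ^+ 2 * e by rewrite mulr_ge0 ?sqr_ge0 // ltW.
  move: (C ^+ 2) => C2; lra.
have n2 : (L2norm (- b) b (g \- dphi)%R <= (eps / 3)%:E)%E.
  apply: L2norm_le => //; first exact: wp.1.
  apply: le_trans Te.
  have ii i : mu.-integrable D[- b, b] (EFin \o (fun x => (P i < k * x < P i + e)%R%:R)).
    apply: (@integrable_bounded _ _ _ _ 1); first exact: measurable_itv_indic.
    by move=> x _; case: (_ < _ < _); rewrite ?normr1 ?normr0.
  have [isum Esum] := Rintegral_sum (index_enum 'I_n) mD
    (fun i => integrable_EFinZ (C * `|c i|) mD (ii i)).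
  apply: (@le_trans _ _ (\int[mu]_(x in D[- b, b])
      \sum_(i < n) C * `|c i| * (P i < k * x < P i + e)%R%:R)).
    apply: le_Rintegral; [exact: mD|exact: L2_sqr_integrable wp.1|exact: isum|].
    move=> x _; rewrite /= /g /dphi -sumrB.
    have -> : \sum_(i < n) (c i * (k * (P i < k * x)%R%:R) - c i * (k * ramp e k (P i) x)) =
        k * \sum_(i < n) c i * ((P i < k * x)%R%:R - ramp e k (P i) x).
      by rewrite mulr_sumr; apply: eq_bigr => i _; ring.
    rewrite exprMn (_ : k ^+ 2 = 1) ?mul1r; last first.
      by case: k1 => ->; rewrite ?sqrrN expr1n.
    (* The square is estimated as a product of the uniform bound [C] and the sum of windows, which
       makes the integral linear in [e]. *)
    have h1 : `|\sum_(i < n) c i * ((P i < k * x)%R%:R - ramp e k (P i) x)| <= C * 1.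
      apply: sum_norm_le => i; apply: le_trans (ramp_dist k (P i) x e0) _.
      by case: (_ < _ < _).
    have h2 : `|\sum_(i < n) c i * ((P i < k * x)%R%:R - ramp e k (P i) x)| <=
        \sum_(i < n) `|c i| * (P i < k * x < P i + e)%R%:R.
      apply: le_trans (ler_norm_sum _ _ _) _; apply: ler_sum => i _.
      by rewrite normrM ler_wpM2l // ramp_dist.
    rewrite -real_normK ?num_real // expr2.
    under eq_bigr do rewrite -mulrA.
    rewrite -mulr_sumr; rewrite mulr1 in h1.
    by apply: ler_pM.
  rewrite Esum.
  have -> : \sum_(i < n) \int[mu]_(x in D[- b, b]) (C * `|c i| * (P i < k * x < P i + e)%R%:R) =
      \sum_(i < n) C * `|c i| * e.
    apply: eq_bigr => i _; have /andP[pi1 pi2] := Ppr i.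
    rewrite RintegralZl; [|exact: mD|exact: ii].
    have l1 : - b <= P i by rewrite ltW // (lt_le_trans bp).
    have l2 : P i <= P i + e by rewrite lerDl ltW.
    have l3 : P i + e <= b by rewrite ltW // (le_lt_trans _ re) // lerD2r.
    by rewrite (Rintegral_itv_indic k1 l1 l2 l3) addrAC subrr add0r.
  rewrite -mulr_suml -mulr_sumr -/C -expr2 ler_wpM2r ?(ltW e0) // /T.
  have : 0 <= C ^+ 2 by exact: sqr_ge0.
  by move: (C ^+ 2) => C2; nra.
apply: le_lt_trans (leeD n1 n2) _.
by rewrite -EFinD lte_fin; lra.
Qed.

End PiecewiseLinear.

(** * The energy and the sufficiency direction *)

Section Energy.
Context {R : realType}.
Notation mu := (@lebesgue_measure R).
Implicit Types (a b x : R) (N : nat).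

Local Notation "D[ a , b ]" := (`]a, b[%classic : set R).

Definition gaps N (v : 'rV[R]_N) : R :=
  \sum_(i < N) \sum_(j < N | j == i.+1 :> nat) (v ord0 j < v ord0 i)%R%:R.

Definition density N a b (U : R -> 'rV[R]_N) x : R :=
  \sum_(i < N) weak_derivative a b (component U i) x ^+ 2 + gaps (U x).

(** Squares of weak derivatives are integrable and the gap indicators are bounded, so the energy is
    finite and energies can be compared as real integrals. *)
Lemma JN_density N a b (U : R -> 'rV[R]_N) :
  (forall i, H1 a b (component U i)) ->
  mu.-integrable D[a, b] (EFin \o density a b U) /\
  JN a b U = (\int[mu]_(x in D[a, b]) density a b U x)%:E.
Proof.
move=> HU; have mD := @measurable_oo R a b.
have iw i : mu.-integrable D[a, b]
    (EFin \o (fun x => weak_derivative a b (component U i) x ^+ 2)).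
  exact: L2_sqr_integrable (weak_derivative_spec (HU i)).1.
have ig i j : mu.-integrable D[a, b]
    (EFin \o (fun x => (U x ord0 j < U x ord0 i)%R%:R)).
  apply: (@integrable_bounded _ _ _ _ 1); last first.
    by move=> x _; case: (_ < _); rewrite ?normr1 ?normr0.
  have mU k : measurable_fun D[a, b] (component U k) := L2_measurable (HU k).1.
  have -> : (fun x => (U x ord0 j < U x ord0 i)%R%:R : R) =
      (fun x => if component U j x < component U i x then 1 else 0).
    by apply/funext => x; rewrite /component; case: (_ < _).
  by apply: measurable_fun_if => //; exact: measurable_fun_ltr.
have [i1 _] := Rintegral_sum (index_enum 'I_N) mD iw.
have i2 : mu.-integrable D[a, b] (EFin \o (fun x => gaps (U x))).
  have := (Rintegral_sum (index_enum 'I_N) mD (fun i =>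
    (Rintegral_sum (seq.filter (fun j : 'I_N => j == i.+1 :> nat) (index_enum 'I_N)) mD (ig i)).1)).1.
  apply: eq_integrable => // x _ /=; congr EFin.
  by apply: eq_bigr => i _; rewrite big_filter.
have id : mu.-integrable D[a, b] (EFin \o density a b U).
  by have := integrable_EFinD mD i1 i2.
split=> //; rewrite /Rintegral fineK; last exact: (integrable_fin_num mD id).
apply: eq_integral => x _; congr (_ + _)%:E.
  by apply: eq_bigr => i _; rewrite real_normK ?num_real.
apply: eq_bigr => i _; apply: eq_bigr => j _; rewrite indicE; congr (nat_of_bool _)%:R.
by apply/idP/idP; rewrite inE.
Qed.

(** The difference [g - f] is replaced by its positive part, equal to it almost everywhere and
    nonnegative everywhere. *)
Lemma ae_le_Rintegral a b (f g : R -> R) :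
  mu.-integrable D[a, b] (EFin \o f) -> mu.-integrable D[a, b] (EFin \o g) ->
  {ae mu, forall x, x \in `]a, b[ -> f x <= g x} ->
  \int[mu]_(x in D[a, b]) f x <= \int[mu]_(x in D[a, b]) g x.
Proof.
move=> fi gi fg; have mD := @measurable_oo R a b.
have mf : measurable_fun D[a, b] f by case/integrableP: fi => /measurable_EFinP.
have mg : measurable_fun D[a, b] g by case/integrableP: gi => /measurable_EFinP.
pose h x := Num.max 0 (g x - f x).
have mh : measurable_fun D[a, b] h.
  by apply: measurable_maxr => //; exact: measurable_funB.
have gE : \int[mu]_(x in D[a, b]) (g x - f x) = \int[mu]_(x in D[a, b]) h x.
  rewrite /Rintegral; congr fine; apply: ae_eq_integral => //.
  - by apply/measurable_EFinP; exact: measurable_funB.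
  - exact/measurable_EFinP.
  - apply: ae_imply fg => x H Dx; rewrite /h; congr EFin.
    by apply/esym/max_idPr; rewrite subr_ge0; exact: H.
rewrite -subr_ge0 -RintegralB // gE; apply: Rintegral_ge0 => x _.
by rewrite /h le_max lexx.
Qed.

Lemma gaps_ge0 N (v : 'rV[R]_N) : 0 <= gaps v.
Proof. by apply: sumr_ge0 => i _; apply: sumr_ge0 => j _. Qed.

Lemma gaps_ge1 N (v : 'rV[R]_N) (i j : 'I_N) : j = i.+1 :> nat ->
  v ord0 j < v ord0 i -> 1 <= gaps v.
Proof.
move=> ji vij; rewrite /gaps (bigD1 i) //= (bigD1 j) /=; last by apply/eqP.
rewrite vij -addrA lerDl addr_ge0 //; apply: sumr_ge0 => // l _.
by apply: sumr_ge0.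
Qed.

(** [gaps] is a count, so a value below 1 means that no consecutive pair is strictly ordered;
    induction on the distance of the indices concludes. *)
Lemma gaps_lt1 N (v : 'rV[R]_N) :
  (forall i j : 'I_N, (i <= j)%N -> v ord0 j <= v ord0 i) -> gaps v < 1 ->
  forall i j, v ord0 i = v ord0 j.
Proof.
move=> vd g1.
suff H (i : 'I_N) (n : nat) : forall j : 'I_N, j = (i + n)%N :> nat -> v ord0 j = v ord0 i.
  move=> i j; have [ij|/ltnW ji] := leqP i j.
    by apply/esym/(H i (j - i)%N); rewrite subnKC.
  by apply/(H j (i - j)%N); rewrite subnKC.
elim: n => [j|n IH j jE].
  by rewrite addn0 => /val_inj ->.
have lt : (i + n < N)%N by rewrite (leq_trans _ (ltn_ord j)) // jE addnS.
rewrite -(IH (Ordinal lt)) //; apply/eqP; rewrite eq_le vd /=; last by rewrite jE addnS.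
rewrite leNgt; apply/negP => h; have := gaps_ge1 (i := Ordinal lt) (j := j) _ h.
by rewrite jE addnS leNgt g1 => /(_ erefl).
Qed.

End Energy.

(** * The coefficient vector and its calibration *)

Section Optimal.
Context {R : realType}.
Notation mu := (@lebesgue_measure R).
Implicit Types (a b x : R) (N k : nat).

Local Notation "D[ a , b ]" := (`]a, b[%classic : set R).

Lemma ae_forall (I : finType) (P : I -> R -> Prop) :
  (forall i, {ae mu, forall x, P i x}) -> {ae mu, forall x, forall i, P i x}.
Proof. by apply: filter_forall; exact: (ae_filter_ringOfSetsType mu). Qed.

Lemma sum_threshold N k (x y : R) : (k <= N)%N ->
  \sum_(i < N) (if (i < k)%N then x else y) = k%:R * x + (N - k)%N%:R * y.
Proof.
move=> kN; rewrite -(big_mkord xpredT (fun i => if (i < k)%N then x else y)).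
rewrite (big_cat_nat (n := k)) //=; congr (_ + _).
  rewrite (eq_big_nat _ _ (F2 := fun=> x)) => [|i /andP[_ ->] //].
  by rewrite sumr_const_nat subn0 mulr_natl.
rewrite (eq_big_nat _ _ (F2 := fun=> y)) => [|i /andP[ki _]].
  by rewrite sumr_const_nat mulr_natl.
by rewrite ltnNge ki.
Qed.

Definition upper N k : R := Num.sqrt (k%:R^-1 - N%:R^-1).
Definition lower N k : R := Num.sqrt ((N - k)%N%:R^-1 - N%:R^-1).

Definition coef N k (i : nat) : R := if (i < k)%N then upper N k else - lower N k.

Lemma component_U0 N k (i : 'I_N) x : U0 N k x ord0 i = coef N k i * pospart x.
Proof. by rewrite /U0 mxE /coef; case: ifP. Qed.

Section Coef.
Context (N k : nat) (hk : (1 <= k <= N.-1)%N).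

Let K0 : 0 < k%:R :> R. Proof. by rewrite ltr0n; case/andP: hk. Qed.
Let kN : (k < N)%N.
Proof. by case/andP: hk; case: N => [|n] /=; [case: k|rewrite ltnS]. Qed.
Let M0 : 0 < (N - k)%N%:R :> R. Proof. by rewrite ltr0n subn_gt0. Qed.
Let NE : N%:R = k%:R + (N - k)%N%:R :> R. Proof. by rewrite -natrD subnKC // ltnW. Qed.

Lemma upper_gt0 : 0 < upper N k.
Proof. by rewrite sqrtr_gt0 subr_gt0 ltf_pV2 ?posrE ?NE ?addr_gt0 // ltrDl. Qed.

Lemma lower_gt0 : 0 < lower N k.
Proof. by rewrite sqrtr_gt0 subr_gt0 ltf_pV2 ?posrE ?NE ?addr_gt0 // ltrDr. Qed.

Lemma upper_sqr : upper N k ^+ 2 = k%:R^-1 - N%:R^-1.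
Proof. by rewrite sqr_sqrtr // ltW // -sqrtr_gt0 upper_gt0. Qed.

Lemma lower_sqr : lower N k ^+ 2 = (N - k)%N%:R^-1 - N%:R^-1.
Proof. by rewrite sqr_sqrtr // ltW // -sqrtr_gt0 lower_gt0. Qed.

(** Both sides are nonnegative with square [k * (N - k) / N], which is symmetric in [k] and
    [N - k]. *)
Lemma upper_lower : k%:R * upper N k = (N - k)%N%:R * lower N k.
Proof.
apply/eqP; rewrite -(@eqrXn2 _ 2) ?mulr_ge0 ?ler0n ?ltW ?upper_gt0 ?lower_gt0 //.
rewrite !exprMn upper_sqr lower_sqr NE; apply/eqP; field.
by rewrite !gt_eqF // addr_gt0.
Qed.

Lemma sum_coef : \sum_(i < N) coef N k i = 0.
Proof. by rewrite sum_threshold ?(ltnW kN) // upper_lower mulrN subrr. Qed.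

Lemma sum_coef_sqr : \sum_(i < N) coef N k i ^+ 2 = 1.
Proof.
under eq_bigr do rewrite /coef (fun_if (fun z => z ^+ 2)) sqrrN.
rewrite sum_threshold ?(ltnW kN) // upper_sqr lower_sqr NE; field.
by rewrite !gt_eqF // addr_gt0.
Qed.

Lemma coef_le (i j : nat) : (i <= j)%N -> coef N k j <= coef N k i.
Proof.
move=> ij; rewrite /coef; case: ltnP => jk; case: ltnP => ik //.
  by have := leq_trans (leq_ltn_trans ij jk) ik; rewrite ltnn.
by rewrite (@le_trans _ _ 0) // ?oppr_le0 ltW ?lower_gt0 ?upper_gt0.
Qed.

(** As the coefficients sum to 0, the entry at [k.-1], the last of the upper block, may be
    subtracted from all entries; each product then has factors of equal sign. *)
Lemma coef_pairing_ge0 (v : 'rV[R]_N) :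
  (forall i j : 'I_N, (i <= j)%N -> v ord0 j <= v ord0 i) ->
  0 <= \sum_(i < N) coef N k i * v ord0 i.
Proof.
move=> vd; have pN : (k.-1 < N)%N by rewrite (leq_ltn_trans _ kN) ?leq_pred.
have k0 : (0 < k)%N by case/andP: hk.
have -> : \sum_(i < N) coef N k i * v ord0 i =
    \sum_(i < N) coef N k i * (v ord0 i - v ord0 (Ordinal pN)).
  under [RHS]eq_bigr do rewrite mulrBr.
  by rewrite sumrB -mulr_suml sum_coef mul0r subr0.
apply: sumr_ge0 => i _; rewrite /coef; case: ltnP => ik.
  rewrite mulr_ge0 ?(ltW upper_gt0) // subr_ge0; apply: vd => /=.
  by rewrite -ltnS prednK.
rewrite mulr_le0 ?oppr_le0 ?(ltW lower_gt0) // subr_le0; apply: vd => /=.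
by rewrite (leq_trans (leq_pred k)).
Qed.

(** Cauchy-Schwarz against a unit vector: [|g - s c|^2 >= 0] expands to [|g|^2 - s^2 >= 0]. *)
Lemma coef_pairing_sqr (g : 'I_N -> R) :
  (\sum_(i < N) coef N k i * g i) ^+ 2 <= \sum_(i < N) g i ^+ 2.
Proof.
set s := \sum_(i < N) coef N k i * g i.
have : 0 <= \sum_(i < N) (g i - s * coef N k i) ^+ 2.
  by apply: sumr_ge0 => i _; exact: sqr_ge0.
have -> : \sum_(i < N) (g i - s * coef N k i) ^+ 2 =
  \sum_(i < N) g i ^+ 2 - 2 * s * s + s ^+ 2 * 1.
  transitivity (\sum_(i < N) (g i ^+ 2 - 2 * s * (coef N k i * g i) + s ^+ 2 * coef N k i ^+ 2)).
    by apply: eq_bigr => i _; ring.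
  by rewrite big_split sumrB -!mulr_sumr sum_coef_sqr.
by rewrite mulr1; nra.
Qed.

Lemma gaps_U0_le1 x : gaps (U0 N k x) <= (0 < x)%R%:R.
Proof.
have [x0|x0] := leP x 0.
  rewrite /gaps big1 // => i _; apply: big1 => j _.
  by rewrite !component_U0 pospart_le // !mulr0 ltxx.
have pN : (k.-1 < N)%N by rewrite (leq_ltn_trans _ kN) ?leq_pred.
have k0 : (0 < k)%N by case/andP: hk.
(* Only the pair that starts at [k.-1] straddles the two blocks and can be open. *)
rewrite /gaps (bigD1 (Ordinal pN)) //= [X in _ + X]big1 => [|i ip]; last first.
  apply: big1 => j /eqP ji; rewrite !component_U0 /coef ji.
  have -> : (i.+1 < k)%N = (i < k)%N; last by rewrite ltxx.
  have ip' : i != k.-1 :> nat by apply: contra ip => /eqP ip; apply/eqP/val_inj.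
  apply/idP/idP => [/ltnW //|ik]; rewrite -(prednK k0) ltnS ltn_neqAle ip' /=.
  by rewrite -ltnS prednK.
rewrite addr0 prednK // (big_pred1 (Ordinal kN)) => [|j]; last first.
  by rewrite /= -val_eqE.
by case: (_ < _).
Qed.

Lemma U0_minimizer a b (s : R) : s = 1 \/ s = -1 ->
  minimizer a b (fun x => U0 N k (s * x)).
Proof.
move=> s1; set U := (fun x => U0 N k (s * x)).
have s2 : s * s = 1 by case: s1 => ->; rewrite ?mulrNN mulr1.
have mD := @measurable_oo R a b.
have UE i x : component U i x = coef N k i * pospart (s * x - 0).
  by rewrite /component /U component_U0 subr0.
have Lpos := continuous_L2 a b (@continuous_pospart R s 0).
have LU i : L2 a b (component U i).
  by apply: (eq_L2 _ (L2Z (coef N k i) Lpos)) => x _; rewrite UE.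
have wU i : is_weak_derivative a b (component U i) (fun x => coef N k i * (s * (0 < s * x)%R%:R)).
  apply: eq_weak_derivative (weak_derivativeZ (coef N k i) Lpos (weak_derivative_pospart a b 0 s1)) => x _ /=.
    by rewrite UE.
  by [].
have H1U i : H1 a b (component U i) by split=> //; eexists; exact: wU.
split.
  split=> //; apply: aeW => x _ i j ij; rewrite !UE ler_wpM2r ?pospart_ge0 //.
  exact: coef_le.
move=> V [H1V Vord] VU.
have [iU ->] := JN_density H1U; have [iV ->] := JN_density H1V.
rewrite lee_fin.
have H1wU i := weak_derivative_spec (H1U i).
have H1wV i := weak_derivative_spec (H1V i).
set gU := fun i => weak_derivative a b (component U i) in H1wU.
set gV := fun i => weak_derivative a b (component V i) in H1wV.
have iw (W : 'I_N -> R -> R) : (forall i, L2 a b (W i)) ->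
    mu.-integrable D[a, b] (EFin \o (fun x => 2 * s * \sum_(i < N) coef N k i * W i x)) /\
    \int[mu]_(x in D[a, b]) (2 * s * \sum_(i < N) coef N k i * W i x) =
    2 * s * \sum_(i < N) coef N k i * \int[mu]_(x in D[a, b]) W i x.
  move=> LW; have iW i := L2_integrable (LW i).
  have [i1 E1] := Rintegral_sum (index_enum 'I_N) mD (fun i => integrable_EFinZ (coef N k i) mD (iW i)).
  split; first exact: integrable_EFinZ.
  rewrite RintegralZl // E1; congr (_ * _); apply: eq_bigr => i _.
  by rewrite RintegralZl.
have [iU2 EU2] := iw gU (fun i => (H1wU i).1).
have [iV2 EV2] := iw gV (fun i => (H1wV i).1).
(* The middle term is the integral of [2 * s * l']. For [U] the derivative part of the density is
   the indicator of [0 < s * x], the gap part is at most that, and [2 * s * l'] is twice it. *)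
apply: (@le_trans _ _ (\int[mu]_(x in D[a, b]) (2 * s * \sum_(i < N) coef N k i * gU i x))).
  apply: ae_le_Rintegral => //.
  have ext : {ae mu, forall x, forall i : 'I_N, x \in `]a, b[ ->
      gU i x = coef N k i * (s * (0 < s * x)%R%:R)}.
    by apply: ae_forall => i; exact: weak_derivative_unique (LU i) (H1wU i) (wU i).
  apply: ae_imply ext => x H xab; rewrite /density.
  under eq_bigr do rewrite -[weak_derivative _ _ _ _]/(gU _ _) (H _ xab).
  under [in leRHS]eq_bigr do rewrite (H _ xab).
  have -> : \sum_(i < N) (coef N k i * (s * (0 < s * x)%R%:R)) ^+ 2 = (0 < s * x)%R%:R.
    under eq_bigr do rewrite exprMn.
    rewrite -mulr_suml sum_coef_sqr mul1r expr2 mulrACA s2 mul1r.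
    by case: (0 < _); rewrite ?mulr1 ?mulr0.
  have -> : \sum_(i < N) coef N k i * (coef N k i * (s * (0 < s * x)%R%:R)) = s * (0 < s * x)%R%:R.
    by under eq_bigr do rewrite mulrA -expr2; rewrite -mulr_suml sum_coef_sqr mul1r.
  have := gaps_U0_le1 (s * x); rewrite -/(U x).
  have -> : 2 * s * (s * (0 < s * x)%R%:R) = 2 * (0 < s * x)%R%:R.
    by rewrite mulrA -(mulrA 2) s2 mulr1.
  by move=> le; rewrite mulr_natl mulr2n lerD2l.
have -> : \int[mu]_(x in D[a, b]) (2 * s * \sum_(i < N) coef N k i * gU i x) =
    \int[mu]_(x in D[a, b]) (2 * s * \sum_(i < N) coef N k i * gV i x).
  have E i : \int[mu]_(x in D[a, b]) gU i x = \int[mu]_(x in D[a, b]) gV i x.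
    apply/esym/eqP; rewrite -subr_eq0; apply/eqP.
    rewrite -RintegralB; [|exact: mD|exact: L2_integrable (H1wV i).1|exact: L2_integrable (H1wU i).1].
    apply: (H10_Rintegral (VU i)).
    exact: weak_derivativeB (H1V i).1 (LU i) (H1wV i) (H1wU i).
  rewrite EU2 EV2; under eq_bigr do rewrite E.
  reflexivity.
have [Ll wl] := weak_derivative_sum (coef N k) (fun i => (H1V i).1) H1wV.
have l0 : {ae mu, forall x, x \in `]a, b[ -> 0 <= \sum_(i < N) coef N k i * component V i x}.
  by apply: ae_imply Vord => x H xab; apply: coef_pairing_ge0 => i j ij; exact: H.
apply: ae_le_Rintegral => //.
apply: ae_imply2 Vord (weak_derivative_eq0 Ll wl l0) => x ord H xab; rewrite /density.
set q := \sum_(i < N) coef N k i * gV i x.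
have q2 : q ^+ 2 <= \sum_(i < N) weak_derivative a b (component V i) x ^+ 2.
  exact: coef_pairing_sqr.
have V0 := gaps_ge0 (V x).
(* Either an open gap supplies the 1 in [2 * s * q <= q ^ 2 + 1], or all components agree at [x], so
   that [l] vanishes there because the coefficients sum to 0, and hence [q = 0]. *)
have [g1|g1] := ltP (gaps (V x)) 1; last first.
  have h : 2 * s * q <= q ^+ 2 + s * s.
    rewrite -subr_ge0 (_ : _ - _ = (q - s) ^+ 2) ?sqr_ge0 //; ring.
  by apply: le_trans h _; rewrite s2; exact: lerD.
have -> : q = 0.
  apply: (H xab); have [i0|N0] := pickP 'I_N; last by rewrite big1 // => i; have := N0 i.
  have cst := gaps_lt1 (ord xab) g1.
  under eq_bigr do rewrite /component (cst _ i0).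
  by rewrite -mulr_suml sum_coef mul0r.
by rewrite mulr0 addr_ge0 // sumr_ge0 // => i _; exact: sqr_ge0.
Qed.

End Coef.
End Optimal.

(** * Competitors and the necessity direction *)

Section Competitor.
Context {R : realType}.
Notation mu := (@lebesgue_measure R).
Implicit Types (x y t k : R) (N : nat).

Local Notation "D[ a , b ]" := (`]a, b[%classic : set R).

Definition cone N (A B : 'rV[R]_N) y : 'rV[R]_N := pospart y *: A + pospart (- y) *: B.

(** The coefficients for the kinks 0, [t] and 1 are determined, once the first is -1, by the two
    vanishing moments that [piecewise_linear_H10] requires. *)
Definition dent_coef t (i : 'I_3) : R := nth 0 [:: -1; (1 - t)^-1; - (t / (1 - t))] i.
Definition dent_point t (i : 'I_3) : R := nth 0 [:: 0; t; 1] i.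

(* Adding [dent t] to the positive part moves its kink from 0 to [t], the value
   1 at 1 and everything to the right being kept. *)
Definition dent t y : R := \sum_(i < 3) dent_coef t i * pospart (y - dent_point t i).
Definition dent_slope t y : R := \sum_(i < 3) dent_coef t i * (dent_point t i < y)%R%:R.

Lemma dentE t y : dent t y =
  - pospart y + pospart (y - t) / (1 - t) - t / (1 - t) * pospart (y - 1).
Proof.
rewrite /dent !big_ord_recl big_ord0 /dent_coef /dent_point /= subr0.
by rewrite addr0 mulN1r mulNr addrA [(1 - t)^-1 * _]mulrC.
Qed.

Lemma dent_slopeE t y : dent_slope t y =
  - (0 < y)%R%:R + (t < y)%R%:R / (1 - t) - t / (1 - t) * (1 < y)%R%:R.
Proof.
rewrite /dent_slope !big_ord_recl big_ord0 /dent_coef /dent_point /=.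
by rewrite addr0 mulN1r mulNr addrA [(1 - t)^-1 * _]mulrC.
Qed.

Definition slope N (A B : 'rV[R]_N) (i : 'I_N) y : R :=
  A ord0 i * (0 < y)%R%:R - B ord0 i * (0 < - y)%R%:R.

Lemma ae_neq_scaled k (c : R) : k = 1 \/ k = -1 -> {ae mu, forall x, k * x != c}.
Proof.
move=> k1; exists [set k * c]; split.
- exact: measurable_set1.
- exact: lebesgue_measure_set1.
- move=> x /= /negP; rewrite negbK => /eqP <-.
  by rewrite mulrA; case: k1 => ->; rewrite ?mulrNN !mul1r.
Qed.

Section Competitors.
Context (N : nat) (A B : 'rV[R]_N) (k : R) (k1 : k = 1 \/ k = -1).

Definition competitor (W : 'rV[R]_N) t x : 'rV[R]_N :=
  cone A B (k * x) + dent t (k * x) *: W.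

Let k1' : - k = 1 \/ - k = -1.
Proof. by case: k1 => ->; [right|left; rewrite opprK]. Qed.

Let k2 : k * k = 1.
Proof. by case: k1 => ->; rewrite ?mulrNN mulr1. Qed.

Lemma dent_H1 a b t : L2 a b (fun x => dent t (k * x)) /\
  is_weak_derivative a b (fun x => dent t (k * x)) (fun x => k * dent_slope t (k * x)).
Proof.
have [L w] := piecewise_linear_weak_derivative a b (dent_coef t) (dent_point t) k1.
split=> //; apply: eq_weak_derivative w => x _ //.
by rewrite /dent_slope mulr_sumr; apply: eq_bigr => i _; rewrite mulrCA.
Qed.

Lemma competitor_H1 a b W t i : L2 a b (component (competitor W t) i) /\
  is_weak_derivative a b (component (competitor W t) i)
    (fun x => k * (slope A B i (k * x) + W ord0 i * dent_slope t (k * x))).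
Proof.
have Lp := continuous_L2 a b (@continuous_pospart R k 0).
have Lm := continuous_L2 a b (@continuous_pospart R (- k) 0).
have wp := weak_derivative_pospart a b 0 k1.
have wm := weak_derivative_pospart a b 0 k1'.
have [Ld wd] := dent_H1 a b t.
have E x : component (competitor W t) i x = A ord0 i * pospart (k * x - 0) +
    B ord0 i * pospart (- k * x - 0) + W ord0 i * dent t (k * x).
  by rewrite /component /competitor /cone !mxE !subr0 mulNr ![_ * pospart _]mulrC [W _ _ * _]mulrC.
have LA := L2Z (A ord0 i) Lp; have LB := L2Z (B ord0 i) Lm; have LW := L2Z (W ord0 i) Ld.
split.
  by apply: (eq_L2 _ (L2D (L2D LA LB) LW)) => x _; rewrite E.
apply: eq_weak_derivative (weak_derivativeD (L2D LA LB) LW (weak_derivativeD LA LB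
  (weak_derivativeZ (A ord0 i) Lp wp) (weak_derivativeZ (B ord0 i) Lm wm))
  (weak_derivativeZ (W ord0 i) Ld wd)) => x _.
  by rewrite E.
by rewrite /slope /= !mulNr; ring.
Qed.

Lemma competitor_density a b W t : {ae mu, forall x, x \in `]a, b[ ->
  density a b (competitor W t) x =
  \sum_(i < N) (slope A B i (k * x) + W ord0 i * dent_slope t (k * x)) ^+ 2 +
  gaps (competitor W t x)}.
Proof.
have H1c i : H1 a b (component (competitor W t) i).
  by have [L w] := competitor_H1 a b W t i; split=> //; eexists; exact: w.
have H := ae_forall (fun i => weak_derivative_unique (competitor_H1 a b W t i).1
  (weak_derivative_spec (H1c i)) (competitor_H1 a b W t i).2).
apply: ae_imply H => x H xab; rewrite /density; congr (_ + _).
apply: eq_bigr => i _; rewrite (H i xab) exprMn.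
by rewrite expr2 k2 mul1r.
Qed.

Lemma dent_H10 t (c : R) : -1 < t < 1 -> H10 (-2) 2 (fun x => c * dent t (k * x)).
Proof.
move=> /andP[t0 t1]; have t1' : 1 - t != 0 by rewrite subr_eq0 gt_eqF.
have -> : (fun x => c * dent t (k * x)) =
    (fun x => \sum_(i < 3) (c * dent_coef t i) * pospart (k * x - dent_point t i)).
  apply/funext => x; rewrite /dent mulr_sumr; apply: eq_bigr => i _.
  by rewrite mulrA.
apply: (@piecewise_linear_H10 _ 2 3 k _ (dent_point t) (-1) 1 k1).
- by lra.
- by lra.
- by lra.
- by case=> -[|[|[|//]]] i; rewrite /dent_point /=; apply/andP; split; lra.
- by rewrite !big_ord_recl big_ord0 /dent_coef /=; field.
- by rewrite !big_ord_recl big_ord0 /dent_coef /dent_point /=; field.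
Qed.

(** Reduces minimality to a scalar inequality: a pointwise bound of the change of energy by two step
    functions in [k * x], valid off the null set of kinks, is integrated over []-2, 2[], which
    contains all kinks. *)
Lemma competitor_le (W : 'rV[R]_N) t (c1 p1 q1 c2 p2 q2 : R) : -1 < t < 1 ->
  -2 <= p1 -> p1 <= q1 -> q1 <= 2 -> -2 <= p2 -> p2 <= q2 -> q2 <= 2 ->
  minimizer (-2) 2 (fun x => cone A B (k * x)) ->
  (forall x (i j : 'I_N), (i <= j)%N -> competitor W t x ord0 j <= competitor W t x ord0 i) ->
  (forall x, k * x != 0 -> k * x != t -> k * x != 1 ->
    \sum_(i < N) ((slope A B i (k * x) + W ord0 i * dent_slope t (k * x)) ^+ 2 -
                  slope A B i (k * x) ^+ 2) +
    (gaps (competitor W t x) - gaps (cone A B (k * x))) <=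
    c1 * (p1 < k * x < q1)%R%:R + c2 * (p2 < k * x < q2)%R%:R) ->
  0 <= c1 * (q1 - p1) + c2 * (q2 - p2).
Proof.
move=> t1 hp1 hpq1 hq1 hp2 hpq2 hq2 [_ umin] Vord Hle.
have mD := @measurable_oo R (-2) 2.
(* The cone is itself the competitor with direction 0, so one density formula covers both sides. *)
have UE : (fun x => cone A B (k * x)) = competitor 0 t.
  by apply/funext => x; rewrite /competitor scaler0 addr0.
have H1c W' i : H1 (-2) 2 (component (competitor W' t) i).
  by have [L w] := competitor_H1 (-2) 2 W' t i; split=> //; eexists; exact: w.
have := umin (competitor W t) _ _.
rewrite UE (JN_density (H1c 0)).2 (JN_density (H1c W)).2 lee_fin => le.
have {}le : \int[mu]_(x in D[-2, 2]) density (-2) 2 (competitor 0 t) x <=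
    \int[mu]_(x in D[-2, 2]) density (-2) 2 (competitor W t) x.
  apply: le.
    by split => //; apply: aeW => x _ i j; exact: Vord.
  move=> i; have -> : component (competitor W t) i \- component (competitor 0 t) i =
      (fun x => W ord0 i * dent t (k * x)).
    apply/funext => x; rewrite /= /component /competitor !mxE; ring.
  exact: dent_H10.
have iU := (JN_density (H1c 0)).1; have iV := (JN_density (H1c W)).1.
have ii (p q : R) : mu.-integrable D[-2, 2] (EFin \o (fun x => (p < k * x < q)%R%:R)).
  apply: (@integrable_bounded _ _ _ _ 1); first exact: measurable_itv_indic.
  by move=> x _; case: (_ < _ < _); rewrite ?normr1 ?normr0.
have i1 := integrable_EFinZ c1 mD (ii p1 q1); have i2 := integrable_EFinZ c2 mD (ii p2 q2).
have i12 := integrable_EFinD mD i1 i2.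
have hE : \int[mu]_(x in D[-2, 2]) (c1 * (p1 < k * x < q1)%R%:R + c2 * (p2 < k * x < q2)%R%:R) =
    c1 * (q1 - p1) + c2 * (q2 - p2).
  rewrite RintegralD; [|exact: mD|exact: i1|exact: i2].
  rewrite RintegralZl; [|exact: mD|exact: ii].
  rewrite RintegralZl; [|exact: mD|exact: ii].
  by rewrite !Rintegral_itv_indic.
have : \int[mu]_(x in D[-2, 2]) density (-2) 2 (competitor W t) x <=
    \int[mu]_(x in D[-2, 2]) (density (-2) 2 (competitor 0 t) x +
      (c1 * (p1 < k * x < q1)%R%:R + c2 * (p2 < k * x < q2)%R%:R)).
  apply: ae_le_Rintegral => //; first exact: (integrable_EFinD mD iU i12).
  have e3 := ae_imply2 (fun x => @conj _ _) (ae_neq_scaled 0 k1)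
    (ae_imply2 (fun x => @conj _ _) (ae_neq_scaled t k1) (ae_neq_scaled 1 k1)).
  apply: ae_imply2 e3 (ae_imply2 (fun x => @conj _ _)
    (competitor_density (-2) 2 W t) (competitor_density (-2) 2 0 t)).
  move=> x [x0 [xt x1]] [EV EU] xab; rewrite (EV xab) (EU xab).
  have := Hle x x0 xt x1; rewrite sumrB.
  have -> : competitor 0 t x = cone A B (k * x) by rewrite -UE.
  have -> : \sum_(i < N) (slope A B i (k * x) + (0 : 'rV[R]_N) ord0 i * dent_slope t (k * x)) ^+ 2 =
      \sum_(i < N) slope A B i (k * x) ^+ 2.
    by apply: eq_bigr => i _; rewrite mxE mul0r addr0.
  by move=> h; rewrite -lerBlDl; apply: le_trans h; rewrite le_eqVlt; apply/orP; left; apply/eqP; ring.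
rewrite RintegralD; [|exact: mD|exact: iU|exact: i12].
by rewrite hE => h; have := le_trans le h; rewrite lerDl.
Qed.

End Competitors.
End Competitor.

(** * Energy inequalities from moving the kink *)

Section Inequalities.
Context {R : realType}.
Implicit Types (x y t k : R) (N : nat).

Definition decreasing N (v : 'rV[R]_N) : Prop :=
  forall i j : 'I_N, (i <= j)%N -> v ord0 j <= v ord0 i.

Lemma gapsZ N (v : 'rV[R]_N) x : 0 < x -> gaps (x *: v) = gaps v.
Proof.
move=> x0; apply: eq_bigr => i _; apply: eq_bigr => j _.
by rewrite !mxE ltr_pM2l.
Qed.

Lemma gaps0 N : gaps (0 : 'rV[R]_N) = 0.
Proof. by apply: big1 => i _; apply: big1 => j _; rewrite !mxE ltxx. Qed.

Lemma decreasing_cone N (A B W : 'rV[R]_N) x y z : decreasing A -> decreasing B ->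
  decreasing W -> 0 <= x -> 0 <= y -> 0 <= z -> decreasing (x *: A + y *: B + z *: W).
Proof.
move=> dA dB dW x0 y0 z0 i j ij; rewrite !mxE !lerD ?ler_wpM2l //.
- exact: dA.
- exact: dB.
- exact: dW.
Qed.

(** This factor multiplies [A] after the kink has moved to [t]; its sign keeps the competitor
    ordered. *)
Lemma pospart_dent t y : 0 < t < 1 -> 0 <= pospart y + dent t y.
Proof.
move=> /andP[t0 t1]; have s0 : 0 < 1 - t by lra.
rewrite dentE.
have -> : pospart y + (- pospart y + pospart (y - t) / (1 - t) - t / (1 - t) * pospart (y - 1)) =
    (pospart (y - t) - t * pospart (y - 1)) / (1 - t) by field; rewrite gt_eqF.
apply: divr_ge0 (ltW s0); rewrite subr_ge0.
have [y1|y1] := leP y 1.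
  by rewrite (@pospart_le _ (y - 1)) ?mulr0 ?pospart_ge0 // subr_le0.
by rewrite !pospart_ge; [nra|lra|lra].
Qed.

(** The profile with the earlier kink lies above the positive part, so adding an ordered direction
    preserves the ordering. *)
Lemma dent_ge0 t y : -1 < t < 0 -> 0 <= dent t y.
Proof.
move=> /andP[t1 t0]; have s0 : 0 < 1 - t by lra.
rewrite dentE.
have -> : - pospart y + pospart (y - t) / (1 - t) - t / (1 - t) * pospart (y - 1) =
    (pospart (y - t) - (1 - t) * pospart y - t * pospart (y - 1)) / (1 - t).
  by field; rewrite gt_eqF.
apply: divr_ge0 (ltW s0).
have [y0|y0] := leP y 0.
  rewrite (pospart_le y0) (@pospart_le _ (y - 1)); last lra.
  by rewrite !mulr0 !subr0 pospart_ge0.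
have [y1|y1] := leP y 1.
  rewrite (pospart_ge (ltW y0)) (@pospart_le _ (y - 1)) ?pospart_ge; try lra.
  nra.
by rewrite !pospart_ge; try lra; nra.
Qed.

Section Minimizer.
Context (N : nat) (A B : 'rV[R]_N) (k : R) (k1 : k = 1 \/ k = -1)
  (dA : decreasing A) (dB : decreasing B)
  (umin : minimizer (-2) 2 (fun x => cone A B (k * x))).

Let norm2 (v : 'rV[R]_N) := \sum_(i < N) v ord0 i ^+ 2.
Let dot (v w : 'rV[R]_N) := \sum_(i < N) v ord0 i * w ord0 i.

(** Delaying the kink saves [norm2 A + gaps A] on []0, t[] and steepens the slope by the factor
    [1 / (1 - t) = 1 + d] on []t, 1[], at the price [norm2 A * (2 * d + d ^ 2)]. The total is
    [d * (norm2 A - gaps A * (1 - t))]. *)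
Lemma late_kink t : 0 < t < 1 -> gaps A * (1 - t) <= norm2 A.
Proof.
move=> t01; have /andP[t0 t1] := t01; have s0 : 0 < 1 - t by lra.
have s0' : 1 - t != 0 by rewrite gt_eqF.
pose d := t / (1 - t).
have ord x : decreasing (competitor A B k A t x).
  have -> : competitor A B k A t x =
      (pospart (k * x) + dent t (k * x)) *: A + pospart (- (k * x)) *: B + 0 *: A.
    by rewrite /competitor /cone scalerDl scale0r addr0 addrAC.
  by apply: decreasing_cone => //; [exact: pospart_dent|exact: pospart_ge0].
have := @competitor_le R N A B k k1 A t (- norm2 A - gaps A) 0 t (norm2 A * (2 * d + d ^+ 2)) t 1.
have hle x : k * x != 0 -> k * x != t -> k * x != 1 ->
    \sum_(i < N) ((slope A B i (k * x) + A ord0 i * dent_slope t (k * x)) ^+ 2 -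
                  slope A B i (k * x) ^+ 2) +
    (gaps (competitor A B k A t x) - gaps (cone A B (k * x))) <=
    (- norm2 A - gaps A) * (0 < k * x < t)%R%:R +
    norm2 A * (2 * d + d ^+ 2) * (t < k * x < 1)%R%:R.
  rewrite /competitor /slope; set y := k * x => y0 yt y1.
  rewrite dent_slopeE oppr_gt0 /cone.
  have [yneg|ypos|yE] := ltgtP y 0; last by rewrite yE eqxx in y0.
  - have [-> -> ->] : [/\ (t < y) = false, (1 < y) = false & dent t y = 0].
      split; [lra|lra|].
      by rewrite dentE !pospart_le ?mul0r ?mulr0 ?oppr0 ?subr0 ?addr0 //; lra.
    rewrite scale0r addr0 subrr /= !mulr0 !addr0.
    rewrite big1 ?lexx // => i _; ring.
  - have -> : pospart (- y) = 0 by apply: pospart_le; lra.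
    rewrite scale0r addr0 (pospart_ge (ltW ypos)) gapsZ //=.
    have [yt'|yt'|yE] := ltgtP y t; last by rewrite yE eqxx in yt.
    + have -> : (1 < y) = false by lra.
      have -> : dent t y = - y.
        by rewrite dentE (pospart_ge (ltW ypos)) !pospart_le; [ring|lra|lra].
      rewrite scaleNr subrr gaps0 /= !mulr0 mul0r mulr1 addr0 !sub0r.
      rewrite addr0 lerD2r -sumrN le_eqVlt; apply/orP; left; apply/eqP.
      by apply: eq_bigr => i _; ring.
    + have [y1'|y1'|yE] := ltgtP y 1; last by rewrite yE eqxx in y1.
      * rewrite -scalerDl gapsZ; last first.
          rewrite dentE (pospart_ge (ltW ypos)) (@pospart_ge _ (y - t)); last lra.
          rewrite (@pospart_le _ (y - 1)); last lra.
          rewrite mulr0 subr0 addrA subrr add0r divr_gt0 //; lra.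
        rewrite subrr addr0 /= !mulr0 !mulr1 add0r mulr_suml.
        rewrite le_eqVlt; apply/orP; left; apply/eqP.
        by apply: eq_bigr => i _; rewrite /d; field.
      * have -> : dent t y = 0.
          by rewrite dentE (pospart_ge (ltW ypos)) !pospart_ge; [field|lra|lra].
        rewrite scale0r addr0 gapsZ // subrr addr0 /= !mulr0 addr0.
        rewrite big1 ?lexx // => i _; rewrite mulr1; field; exact: s0'.
move=> /(_ _ _ _ _ _ _ _ umin ord hle) H.
have {H} : 0 <= (- norm2 A - gaps A) * (t - 0) + norm2 A * (2 * d + d ^+ 2) * (1 - t).
  by apply: H; try (apply/andP; split); lra.
have -> : (- norm2 A - gaps A) * (t - 0) + norm2 A * (2 * d + d ^+ 2) * (1 - t) =
    d * (norm2 A - gaps A * (1 - t)) by rewrite /d; field.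
by rewrite pmulr_rge0 ?divr_gt0 // subr_ge0.
Qed.

Lemma gaps_le_norm2 : gaps A <= norm2 A.
Proof.
rewrite leNgt; apply/negP => lt; have g0 : 0 < gaps A.
  by apply: le_lt_trans lt; apply: sumr_ge0 => i _; exact: sqr_ge0.
have n0 : 0 <= norm2 A by apply: sumr_ge0 => i _; exact: sqr_ge0.
(* For this [t], [late_kink] bounds the mean of [gaps A] and [norm2 A] by [norm2 A]. *)
pose t := (gaps A - norm2 A) / (2 * gaps A).
have t01 : 0 < t < 1.
  apply/andP; split; first by rewrite divr_gt0 ?mulr_gt0 // subr_gt0.
  by rewrite ltr_pdivrMr ?mulr_gt0 //; lra.
have := late_kink t01.
have -> : gaps A * (1 - t) = (gaps A + norm2 A) / 2 by rewrite /t; field; rewrite gt_eqF.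
by lra.
Qed.

(** [P] starts at [- s] instead of 0. The gap hypotheses allow one new gap to the left of 0 and none
    to the right, and [dot A P = norm2 P] evaluates the cross term on the right. The total change is
    at most [s / (1 + s)] times the difference of the two sides. *)
Lemma early_kink (P : 'rV[R]_N) s : decreasing P -> dot A P = norm2 P ->
  (forall x y, 0 < x -> 0 < y -> gaps (x *: B + y *: P) <= gaps B + 1) ->
  (forall x y, 0 < x -> 0 <= y -> gaps (x *: A + y *: P) <= gaps A) ->
  0 < s < 1 -> norm2 P + 2 * dot B P <= 1 + s.
Proof.
move=> dP AP gB gA /andP[s0 s1]; pose t := - s.
have t01 : -1 < t < 0 by rewrite /t; apply/andP; split; lra.
have r0 : 0 < 1 + s by lra.
have r0' : 1 + s != 0 by rewrite gt_eqF.
have tE : 1 - t = 1 + s by rewrite /t opprK.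
have ord x : decreasing (competitor A B k P t x).
  by apply: decreasing_cone => //; rewrite ?pospart_ge0 // dent_ge0.
(* [d] and [e] are the slopes of [dent t] on []t, 0[] and []0, 1[]; [c1] and [c2] bound the energy
   change per unit length there, with the 1 in [c1] paying for the new gap. *)
pose d := (1 + s)^-1; pose c1 := norm2 P * d ^+ 2 - 2 * dot B P * d + 1.
pose e := - (s / (1 + s)); pose c2 := norm2 P * e ^+ 2 + 2 * norm2 P * e.
have sq (u v : 'I_N -> R) z : \sum_(i < N) ((u i + v i * z) ^+ 2 - u i ^+ 2) =
    (\sum_(i < N) v i ^+ 2) * z ^+ 2 + 2 * (\sum_(i < N) u i * v i) * z.
  rewrite mulr_suml mulr_sumr mulr_suml -big_split /=.
  by apply: eq_bigr => i _; ring.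
have := @competitor_le R N A B k k1 P t c1 t 0 c2 0 1.
have hle x : k * x != 0 -> k * x != t -> k * x != 1 ->
    \sum_(i < N) ((slope A B i (k * x) + P ord0 i * dent_slope t (k * x)) ^+ 2 -
                  slope A B i (k * x) ^+ 2) +
    (gaps (competitor A B k P t x) - gaps (cone A B (k * x))) <=
    c1 * (t < k * x < 0)%R%:R + c2 * (0 < k * x < 1)%R%:R.
  rewrite sq /competitor /slope; set y := k * x => y0 yt y1.
  have Dge := dent_ge0 y t01.
  rewrite dent_slopeE oppr_gt0 /cone -/(norm2 P) tE.
  have [yneg|ypos|yE] := ltgtP y 0; last by rewrite yE eqxx in y0.
  - have -> : (1 < y) = false by lra.
    have -> : pospart y = 0 by apply: pospart_le; lra.
    rewrite (@pospart_ge _ (- y)); last lra.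
    have my : 0 < - y by lra.
    rewrite scale0r add0r gapsZ //=.
    have [yt'|yt'|yE] := ltgtP y t; last by rewrite yE eqxx in yt.
    + have -> : dent t y = 0.
        by rewrite dentE !pospart_le ?mul0r ?mulr0 ?oppr0 ?subr0 ?addr0 //; lra.
      rewrite scale0r addr0 gapsZ // subrr /= !(mulr0, mul0r, oppr0, addr0, subr0).
      by rewrite expr0n mulr0.
    + have Dp : 0 < dent t y.
        rewrite dentE (@pospart_le _ y) ?(ltW yneg) // (@pospart_le _ (y - 1)); last lra.
        rewrite (@pospart_ge _ (y - t)); last lra.
        by rewrite oppr0 add0r mulr0 subr0 divr_gt0 //; lra.
      have := gB _ _ my Dp.
      have -> : \sum_(i < N) (A ord0 i * 0%R - B ord0 i * 1%R) * P ord0 i = - dot B P.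
        by rewrite -sumrN; apply: eq_bigr => i _; ring.
      rewrite /c1 /= !(mulr0, mul0r, oppr0, addr0, add0r, subr0, mulr1, mul1r) -/d.
      by move: (gaps _) (gaps _) => g1 g2; lra.
  - have -> : pospart (- y) = 0 by apply: pospart_le; lra.
    rewrite scale0r addr0 (pospart_ge (ltW ypos)) gapsZ //=.
    have -> : (t < y) = true by have /andP[_ h] := t01; lra.
    have -> : \sum_(i < N) (A ord0 i * 1%R - B ord0 i * 0%R) * P ord0 i = norm2 P.
      by rewrite -AP; apply: eq_bigr => i _; ring.
    have := gA _ _ ypos Dge.
    have [y1'|y1'|yE] := ltgtP y 1; last by rewrite yE eqxx in y1.
    + have -> : - 1%:R + true%:R / (1 + s) - t / (1 + s) * false%:R = e.
        by rewrite /e /=; field.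
      rewrite /c2 /= mulr0 mulr1 add0r.
      by move: (gaps _) (gaps _) => g1 g2; lra.
    + have -> : - 1%:R + true%:R / (1 + s) - t / (1 + s) * true%:R = 0 :> R.
        by rewrite /t /=; field.
      rewrite /= !mulr0 expr0n mulr0 !add0r.
      by move: (gaps _) (gaps _) => g1 g2; lra.
move=> H.
have : 0 <= c1 * (0 - t) + c2 * (1 - 0).
  by apply: H umin ord hle; have /andP[? ?] := t01; try (apply/andP; split); lra.
have -> : c1 * (0 - t) + c2 * (1 - 0) =
    s / (1 + s) * (1 + s - (norm2 P + 2 * dot B P)).
  by rewrite /c1 /c2 /d /e /t; field.
by rewrite pmulr_rge0 ?divr_gt0 // subr_ge0.
Qed.

(** The limit of [early_kink] as [s] tends to 0; the cap 1/2 on [r] keeps it in the admissible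
    range. *)
Lemma projection_le1 (P : 'rV[R]_N) : decreasing P -> dot A P = norm2 P ->
  (forall x y, 0 < x -> 0 < y -> gaps (x *: B + y *: P) <= gaps B + 1) ->
  (forall x y, 0 < x -> 0 <= y -> gaps (x *: A + y *: P) <= gaps A) ->
  norm2 P + 2 * dot B P <= 1.
Proof.
move=> dP AP gB gA; apply/ler_addgt0Pr => s s0.
pose r := Num.min s (1 / 2).
have r01 : 0 < r < 1.
  by rewrite lt_min s0 gt_min divr_gt0 //= ltr_pdivrMr // mul1r ltr1n orbT.
by apply: le_trans (early_kink dP AP gB gA r01) _; rewrite lerD2l ge_min lexx.
Qed.

End Minimizer.
End Inequalities.

(** * Ordered vectors of sum zero: block means, Abel summation, equality cases *)

Section Rigidity.
Context {R : realType} (n : nat).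
Implicit Types (v w A B : 'rV[R]_n.+1) (j : nat).

(** Indexing by natural numbers lets the neighbour [l.+1] be written without a bound proof; [inord]
    falls back to index 0 out of range, so bounds return as hypotheses. *)
Let entry v (l : nat) : R := v ord0 (inord l).
Let psum v j : R := \sum_(l < j) entry v l.

Lemma entryE v (i : 'I_n.+1) : v ord0 i = entry v i.
Proof. by rewrite /entry inord_val. Qed.

Lemma entry_le v l m : decreasing v -> (l <= m)%N -> (m <= n)%N -> entry v m <= entry v l.
Proof.
by move=> dv lm mn; apply: dv; rewrite !inordK // ltnS // (leq_trans lm).
Qed.

Lemma gaps_entry v : gaps v = \sum_(i < n) (entry v i.+1 < entry v i)%R%:R.
Proof.
rewrite /gaps big_ord_recr /= [X in _ + X]big_pred0 ?addr0 => [|j]; last first.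
  by apply/negP => /eqP ji; have := ltn_ord j; rewrite ji ltnn.
apply: eq_bigr => i _; have lt : (i.+1 < n.+1)%N by rewrite ltnS.
rewrite (big_pred1 (Ordinal lt)) => [|j /=]; last by rewrite -val_eqE.
by rewrite !entryE.
Qed.

Lemma abel_summation (a : nat -> R) m :
  \sum_(l < m.+1) a l ^+ 2 =
  \sum_(i < m) (a i - a i.+1) * (\sum_(l < i.+1) a l) + a m * \sum_(l < m.+1) a l.
Proof.
elim: m => [|m IH]; first by rewrite !big_ord_recl !big_ord0 /=; ring.
rewrite big_ord_recr /= IH [X in _ = X + _]big_ord_recr /= [X in _ = _ + _ * X]big_ord_recr /=.
set s := \sum_(l < m.+1) a l; set t := \sum_(i < m) _; ring.
Qed.

Lemma psumE v j : (j <= n.+1)%N -> psum v j = \sum_(i < n.+1 | (i < j)%N) v ord0 i.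
Proof.
move=> jn; rewrite /psum (big_ord_widen n.+1 (entry v) jn).
by apply: eq_bigr => i _; rewrite entryE.
Qed.

Section ZeroSum.
Context (v : 'rV[R]_n.+1) (dv : decreasing v) (v0 : \sum_(i < n.+1) v ord0 i = 0).
Context (j : nat) (j0 : (0 < j)%N) (jn : (j <= n)%N).

Let J0 : 0 < j%:R :> R. Proof. by rewrite ltr0n. Qed.
Let M0 : 0 < (n.+1 - j)%N%:R :> R. Proof. by rewrite ltr0n subn_gt0 ltnS. Qed.

(** Subtracting [y] from every coefficient does not change the pairing, because [v] has sum zero. *)
Lemma threshold_dot (x y : R) :
  \sum_(i < n.+1) (if (i < j)%N then x else y) * v ord0 i = (x - y) * psum v j.
Proof.
transitivity (\sum_(i < n.+1) ((x - y) * (if (i < j)%N then v ord0 i else 0) + y * v ord0 i)).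
  by apply: eq_bigr => i _; case: ifP => _; ring.
rewrite big_split /= -!mulr_sumr v0 mulr0 addr0; congr (_ * _).
by rewrite psumE ?(leq_trans jn) // [RHS]big_mkcond.
Qed.

Lemma psum_tail : psum v j = - \sum_(i < n.+1 | ~~ (i < j)%N) v ord0 i.
Proof.
apply/eqP; rewrite -addr_eq0 psumE ?(leq_trans jn) //.
by rewrite -[X in _ == X]v0 [X in _ == X](bigID (fun i : 'I_n.+1 => (i < j)%N)).
Qed.

Lemma sum_low (c : R) : \sum_(i < n.+1 | (i < j)%N) c = j%:R * c.
Proof.
rewrite big_mkcond /=; have := sum_threshold c (0 : R) (leqW jn).
by rewrite mulr0 addr0.
Qed.

Lemma sum_high (c : R) : \sum_(i < n.+1 | ~~ (i < j)%N) c = (n.+1 - j)%N%:R * c.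
Proof.
rewrite big_mkcond /=; have := sum_threshold (0 : R) c (leqW jn).
rewrite mulr0 add0r => <-; apply: eq_bigr => i _.
by case: (i < j)%N.
Qed.

Let low_ge0 i : (i < j)%N -> 0 <= entry v i - entry v j.-1.
Proof.
move=> ij; rewrite subr_ge0; apply: entry_le => //; first by rewrite -ltnS prednK.
by rewrite (leq_trans (leq_pred j)).
Qed.

Let high_ge0 (i : 'I_n.+1) : ~~ (i < j)%N -> 0 <= entry v j - entry v i.
Proof.
by rewrite -leqNgt => ij; rewrite subr_ge0; apply: entry_le => //; rewrite -ltnS.
Qed.

Lemma psum_low : psum v j - j%:R * entry v j.-1 =
  \sum_(i < n.+1 | (i < j)%N) (entry v i - entry v j.-1).
Proof.
rewrite psumE ?(leq_trans jn) // -sum_low -sumrB.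
by apply: eq_bigr => i _; rewrite entryE.
Qed.

Lemma psum_high : psum v j + (n.+1 - j)%N%:R * entry v j =
  \sum_(i < n.+1 | ~~ (i < j)%N) (entry v j - entry v i).
Proof.
rewrite psum_tail -sum_high addrC -sumrB.
by apply: eq_bigr => i _; rewrite entryE.
Qed.

(** The entry at [j.-1] is the smallest of the first [j], hence at most their mean; [entry_high] is
    the dual bound for the largest of the remaining ones. *)
Lemma entry_low : entry v j.-1 <= psum v j / j%:R.
Proof.
rewrite ler_pdivlMr // mulrC -subr_ge0 psum_low; apply: sumr_ge0 => i ij.
exact: low_ge0.
Qed.

Lemma entry_high : - (psum v j / (n.+1 - j)%N%:R) <= entry v j.
Proof.
rewrite lerNl ler_pdivlMr // -subr_ge0 mulNr opprK mulrC psum_high.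
by apply: sumr_ge0 => i; exact: high_ge0.
Qed.

(** Each block is replaced by its mean; the sum of the second block is [- psum v j] because the
    total is 0. *)
Definition proj : 'rV[R]_n.+1 :=
  \row_(i < n.+1) if (i < j)%N then psum v j / j%:R else - (psum v j / (n.+1 - j)%N%:R).

Lemma gap_le : entry v j.-1 - entry v j <= psum v j / j%:R + psum v j / (n.+1 - j)%N%:R.
Proof. by have := entry_low; have := entry_high; lra. Qed.

(** By [gap_le] a positive multiple of [psum v j] dominates a gap, which is nonnegative. *)
Lemma psum_ge0 : 0 <= psum v j.
Proof.
have le : entry v j <= entry v j.-1 by apply: entry_le => //; exact: leq_pred.
have : 0 <= psum v j * (j%:R^-1 + (n.+1 - j)%N%:R^-1).
  rewrite mulrDr; apply: le_trans gap_le; by rewrite subr_ge0.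
by rewrite pmulr_lge0 // addr_gt0 // invr_gt0.
Qed.

(** A largest possible gap makes the two entries beside it equal to their block means. The
    deviations within a block have one sign and now sum to 0, so all entries equal the mean. *)
Lemma gap_eq_proj :
  psum v j / j%:R + psum v j / (n.+1 - j)%N%:R <= entry v j.-1 - entry v j -> v = proj.
Proof.
move=> le; have e1 := entry_low; have e2 := entry_high.
have E1 : entry v j.-1 = psum v j / j%:R by apply/eqP; rewrite eq_le e1 /=; lra.
have E2 : entry v j = - (psum v j / (n.+1 - j)%N%:R) by apply/eqP; rewrite eq_le e2 andbT; lra.
have Z1 : \sum_(i < n.+1 | (i < j)%N) (entry v i - entry v j.-1) = 0.
  by rewrite -psum_low E1; field; rewrite gt_eqF.
have Z2 : \sum_(i < n.+1 | ~~ (i < j)%N) (entry v j - entry v i) = 0.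
  by rewrite -psum_high E2; field; rewrite gt_eqF.
apply/rowP => i; rewrite mxE entryE; case: ifPn => ij.
  move: Z1 => /eqP; rewrite psumr_eq0 => [/allP|l]; last exact: low_ge0.
  by move=> /(_ i (mem_index_enum _)); rewrite ij /= subr_eq0 E1 => /eqP.
move: Z2 => /eqP; rewrite psumr_eq0 => [/allP|l]; last exact: high_ge0.
by move=> /(_ i (mem_index_enum _)); rewrite ij /= subr_eq0 E2 => /eqP.
Qed.

(** If the partial sum is 0, the condition of [gap_eq_proj] holds trivially and both block means are
    0. *)
Lemma psum_eq0 : psum v j = 0 -> v = 0.
Proof.
move=> s0; rewrite gap_eq_proj.
  by apply/rowP => i; rewrite !mxE s0 !mul0r oppr0 if_same.
by rewrite s0 !mul0r addr0 subr_ge0; apply: entry_le => //; exact: leq_pred.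
Qed.

Lemma proj_decreasing : decreasing proj.
Proof.
move=> i l il; rewrite !mxE; case: ifPn => lj; case: ifPn => ij //.
  by case/negP: ij; exact: leq_ltn_trans il lj.
apply: (@le_trans _ _ 0).
  by rewrite oppr_le0 divr_ge0 ?psum_ge0 // ltW.
by rewrite divr_ge0 ?psum_ge0 // ltW.
Qed.

Lemma norm_proj : \sum_(i < n.+1) proj ord0 i ^+ 2 =
  psum v j * (psum v j / j%:R + psum v j / (n.+1 - j)%N%:R).
Proof.
under eq_bigr do rewrite mxE (fun_if (fun z => z ^+ 2)) sqrrN.
rewrite sum_threshold ?(leqW jn) //; field.
by rewrite !gt_eqF.
Qed.

End ZeroSum.

(** With [w = v] this is the value in [norm_proj], hence the orthogonality required by [early_kink];
    with [w = B] it gives the cross term. *)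
Lemma dot_proj v w j : \sum_(i < n.+1) w ord0 i = 0 -> (j <= n)%N ->
  \sum_(i < n.+1) w ord0 i * proj v j ord0 i =
  psum w j * (psum v j / j%:R + psum v j / (n.+1 - j)%N%:R).
Proof.
move=> w0 jn; have := threshold_dot w0 jn (psum v j / j%:R) (- (psum v j / (n.+1 - j)%N%:R)).
rewrite opprK => h; rewrite [RHS]mulrC -h; apply: eq_bigr => i _.
by rewrite mxE mulrC.
Qed.

Lemma proj_gap v j i : (i < n)%N -> i != j.-1 -> (0 < j)%N ->
  entry (proj v j) i.+1 = entry (proj v j) i.
Proof.
move=> lt ij j0; have h1 : (i.+1 < n.+1)%N by rewrite ltnS.
rewrite /entry !mxE (inordK h1) (inordK (ltnW h1)).
suff -> : (i.+1 < j)%N = (i < j)%N by [].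
apply/idP/idP => [/ltnW //|ik]; rewrite -(prednK j0) ltnS ltn_neqAle ij /=.
by rewrite -ltnS prednK.
Qed.

Lemma entryD (x y : R) v w l : entry (x *: v + y *: w) l = x * entry v l + y * entry w l.
Proof. by rewrite /entry !mxE. Qed.

Lemma sum_indicator_le1 m i : \sum_(l < m) (val l == i)%:R <= 1 :> R.
Proof.
have [im|mi] := ltnP i m.
  rewrite (bigD1 (Ordinal im)) //= eqxx big1 ?addr0 // => l.
  by rewrite -val_eqE /= => /negbTE ->.
rewrite big1 // => l _; have := ltn_ord l.
by case: eqP => [->|//]; rewrite ltnNge mi.
Qed.

(** Neighbours in [proj v j] are equal except at [j.-1], so every other comparison is unaffected;
    the indicator of that index pays for the one that may open. *)
Lemma gaps_proj_le v w j x y : (0 < j)%N -> 0 < x -> 0 < y ->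
  gaps (x *: w + y *: proj v j) <= gaps w + 1.
Proof.
move=> j0 x0 y0; rewrite !gaps_entry.
apply: le_trans (lerD (lexx _) (sum_indicator_le1 n j.-1)).
rewrite -big_split /=; apply: ler_sum => i _; rewrite !entryD.
case: (boolP (val i == j.-1)) => [_|ij].
  by rewrite -natrD ler_nat; case: (_ < _); case: (_ < _).
by rewrite (proj_gap v (ltn_ord i) ij j0) addr0 ltrD2r ltr_pM2l.
Qed.

(** The only gap that [proj v j] can have is already open in [v], so no new one is counted. *)
Lemma gaps_proj_eq v j x y : decreasing v -> (0 < j)%N -> (j <= n)%N ->
  entry v j < entry v j.-1 -> 0 < x -> 0 <= y ->
  gaps (x *: v + y *: proj v j) <= gaps v.
Proof.
move=> dv j0 jn gj x0 y0; rewrite !gaps_entry; apply: ler_sum => i _; rewrite !entryD.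
case: (eqVneq (val i) j.-1) => [->|ij].
  by rewrite prednK // gj; case: (_ < _).
by rewrite (proj_gap v (ltn_ord i) ij j0) ltrD2r ltr_pM2l.
Qed.

Lemma cone_rigidity A B (k : R) : k = 1 \/ k = -1 -> decreasing A -> decreasing B ->
  \sum_(i < n.+1) A ord0 i = 0 -> \sum_(i < n.+1) B ord0 i = 0 -> A != 0 ->
  minimizer (-2) 2 (fun x => cone A B (k * x)) ->
  exists2 j, (1 <= j <= n)%N & B = 0 /\ forall i : 'I_n.+1, A ord0 i = coef n.+1 j i.
Proof.
move=> k1 dA dB A0 B0 An0 umin.
(* [projection_le1] for the projection at the gap [i], in terms of partial sums: the first summand
   is [|P|^2], the second [2 <B, P>]. *)
have le1 (i : 'I_n) : entry A i.+1 < entry A i ->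
    psum A i.+1 * (psum A i.+1 / i.+1%:R + psum A i.+1 / (n.+1 - i.+1)%N%:R) +
    2 * (psum B i.+1 * (psum A i.+1 / i.+1%:R + psum A i.+1 / (n.+1 - i.+1)%N%:R)) <= 1.
  move=> gi; have jn : (i.+1 <= n)%N := ltn_ord i.
  rewrite -(dot_proj A B0 jn) -norm_proj //.
  apply: (@projection_le1 _ _ A B k k1 dA dB umin).
  - exact: proj_decreasing.
  - by rewrite dot_proj // norm_proj.
  - by move=> x y x0 y0; exact: gaps_proj_le.
  - by move=> x y x0 y0; exact: gaps_proj_eq.
have mean_ge0 (w : 'rV[R]_n.+1) (dw : decreasing w) (w0 : \sum_(i < n.+1) w ord0 i = 0) (i : 'I_n) :
    0 <= psum w i.+1 / i.+1%:R + psum w i.+1 / (n.+1 - i.+1)%N%:R.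
  by rewrite addr_ge0 // divr_ge0 ?ler0n // psum_ge0.
have term (i : 'I_n) : (entry A i - entry A i.+1) * psum A i.+1 <= (entry A i.+1 < entry A i)%R%:R.
  have [gi|gi] := ltP (entry A i.+1) (entry A i); last first.
    rewrite mulr_le0_ge0 //; first by rewrite subr_le0.
    by apply: psum_ge0.
  apply: le_trans (le1 i gi).
  apply: (@le_trans _ _ (psum A i.+1 * (psum A i.+1 / i.+1%:R + psum A i.+1 / (n.+1 - i.+1)%N%:R))).
    rewrite mulrC ler_wpM2l ?psum_ge0 //.
    by have := @gap_le A dA A0 i.+1 (ltn0Sn _) (ltn_ord i).
  by rewrite lerDl mulr_ge0 // mulr_ge0 ?psum_ge0 // mean_ge0.
have norm_le := gaps_le_norm2 k1 dA dB umin.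
have normE : \sum_(i < n.+1) A ord0 i ^+ 2 = \sum_(i < n) (entry A i - entry A i.+1) * psum A i.+1.
  under eq_bigr do rewrite entryE.
  rewrite abel_summation -[X in _ * X]/(psum A n.+1).
  have -> : psum A n.+1 = 0.
    by rewrite /psum -[RHS]A0; apply: eq_bigr => i _; rewrite entryE.
  by rewrite mulr0 addr0.
rewrite normE gaps_entry in norm_le.
(* The differences of the two sides are nonnegative by [term], and their sum is nonpositive by
   [norm_le]. *)
have eqs (i : 'I_n) : (entry A i - entry A i.+1) * psum A i.+1 = (entry A i.+1 < entry A i)%R%:R.
  have := norm_le; rewrite -subr_ge0 -sumrB => h.
  have nn (l : 'I_n) : true -> 0 <= (entry A l.+1 < entry A l)%R%:R - (entry A l - entry A l.+1) * psum A l.+1.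
    by rewrite subr_ge0 term.
  have : \sum_(l < n) ((entry A l.+1 < entry A l)%R%:R - (entry A l - entry A l.+1) * psum A l.+1) == 0.
    rewrite eq_le sumr_ge0 // andbT -oppr_ge0 -sumrN.
    by under eq_bigr do rewrite opprB.
  rewrite psumr_eq0 // => /allP /(_ i (mem_index_enum _)) /=.
  by rewrite subr_eq0 => /eqP <-.
have [i gi|nog] := pickP (fun i : 'I_n => entry A i.+1 < entry A i); last first.
  have g0 : gaps A = 0.
    by rewrite gaps_entry big1 // => i _; rewrite nog.
  have cst := gaps_lt1 dA _; rewrite g0 in cst; have {}cst := cst ltr01.
  case/eqP: An0; apply/rowP => i; rewrite mxE.
  have := A0; under eq_bigr do rewrite (cst _ i).
  rewrite sumr_const card_ord => /eqP; rewrite mulrn_eq0 /= => /eqP //.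
have jn : (i.+1 <= n)%N := ltn_ord i.
have e : (entry A i - entry A i.+1) * psum A i.+1 = 1 by rewrite eqs gi.
set s := psum A i.+1 in e.
have s0 : 0 < s.
  rewrite lt_neqAle psum_ge0 // andbT eq_sym; apply: contra_eq_neq e => ->.
  by rewrite mulr0 eq_sym oner_eq0.
set m := s / i.+1%:R + s / (n.+1 - i.+1)%N%:R.
have J0 : 0 < i.+1%:R :> R by rewrite ltr0n.
have M0 : 0 < (n.+1 - i.+1)%N%:R :> R by rewrite ltr0n subn_gt0 ltnS.
have m0 : 0 < m by rewrite addr_gt0 // divr_gt0.
have sB0 : 0 <= psum B i.+1 by rewrite psum_ge0.
have := le1 i gi; rewrite -/s -/m => h1.
(* [h1] bounds [s * m] plus a nonnegative multiple of [psum B i.+1] by 1. Together with [h2] this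
   forces [s * m = 1] and [psum B i.+1 = 0]. *)
have h2 : 1 <= s * m.
  rewrite -e mulrC ler_wpM2l ?(ltW s0) //.
  by have := @gap_le A dA A0 i.+1 (ltn0Sn _) jn.
have sB : psum B i.+1 = 0.
  apply/eqP; rewrite eq_le sB0 andbT.
  have : psum B i.+1 * m <= 0 by lra.
  by rewrite pmulr_lle0.
have sm : s * m = 1 by apply/eqP; rewrite eq_le h2 andbT; rewrite sB mul0r mulr0 addr0 in h1.
exists i.+1; first by [].
split; first exact: (psum_eq0 dB B0 _ jn sB).
have -> : A = proj A i.+1.
  apply: gap_eq_proj => //; rewrite -/s -/m /=.
  have s0' : s != 0 by rewrite gt_eqF.
  by rewrite le_eqVlt; apply/orP; left; apply/eqP/(mulfI s0'); rewrite sm -e mulrC.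
have NE : n.+1%:R = i.+1%:R + (n.+1 - i.+1)%N%:R :> R by rewrite -natrD subnKC // ltnW.
(* The normalisation [s * m = 1] means [s ^ 2 = x * y / (x + y)] for block sizes [x] and [y]; this
   is where the square roots in [U0] come from. *)
have q (x y : R) : 0 < x -> 0 < y -> s * (s / x + s / y) = 1 -> Num.sqrt (x^-1 - (x + y)^-1) = s / x.
  move=> x0 y0 sxy; have -> : x^-1 - (x + y)^-1 = (s / x) ^+ 2.
    have -> : (s / x) ^+ 2 = s * (s / x + s / y) * (x^-1 - (x + y)^-1).
      by field; rewrite !gt_eqF // addr_gt0.
    by rewrite sxy mul1r.
  by rewrite sqrtr_sqr ger0_norm // divr_ge0 // ltW.
move=> l; rewrite mxE /coef /upper /lower NE -/s.
case: ifP => _; first by rewrite (q _ _ J0 M0 sm).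
by congr (- _); rewrite [_ + (_ - _)%N%:R]addrC (q _ _ M0 J0) // [_ / _ + _]addrC.
Qed.

End Rigidity.

(** * Reduction of cones to their two half-lines, and the characterization *)

Lemma cone_of_homogeneous (R : realType) N (U : R -> 'rV[R]_N) : homogeneous1 U ->
  U = cone (U 1) (U (-1)).
Proof.
move=> hU; apply/funext => x; rewrite /cone.
have [x0|x0|->] := ltgtP x 0.
- rewrite pospart_le ?(ltW x0) // scale0r add0r pospart_ge ?oppr_ge0 ?(ltW x0) //.
  by rewrite -hU ?oppr_gt0 // mulrN1 opprK.
- rewrite pospart_ge ?(ltW x0) // (@pospart_le _ (- x)) ?oppr_le0 ?(ltW x0) //.
  by rewrite scale0r addr0 -hU // mulr1.
(* At 0, homogeneity with factor 2 reads [U 0 = 2 *: U 0], so [U 0 = 0]. *)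
- rewrite oppr0 pospart_le // !scale0r addr0.
  have := hU 2 0 (ltr0n _ _); rewrite mulr0 scaler_nat mulr2n => /eqP.
  by rewrite -[X in X == _]addr0 (inj_eq (addrI _)) eq_sym => /eqP.
Qed.

(** Admissibility orders the components only almost everywhere. An interval on the side of [e]
    contains a point where they are ordered, and homogeneity carries the ordering from there to
    [e]. *)
Lemma minimizer_decreasing (R : realType) N (U : R -> 'rV[R]_N) (e : R) :
  homogeneous1 U -> minimizer (-2) 2 U -> e = 1 \/ e = -1 -> decreasing (U e).
Proof.
move=> hU [[_ ord] _] e1 i j ij.
have [p [q [pq sub pos]]] : exists p q : R, [/\ p < q,
    forall x, x \in `]p, q[ -> x \in `]-2, 2[ & forall x, x \in `]p, q[ -> 0 < e * x].
  case: e1 => ->.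
    exists 0, 1; split => [|x|x]; first exact: ltr01.
      by rewrite !in_itv /= => /andP[? ?]; apply/andP; split; lra.
    by rewrite in_itv /= mul1r => /andP[].
  exists (-1), 0; split => [|x|x]; first by rewrite oppr_lt0.
    by rewrite !in_itv /= => /andP[? ?]; apply/andP; split; lra.
  by rewrite in_itv /= mulN1r oppr_gt0 => /andP[].
have [x xpq H] := ae_exists_itv pq ord.
have := H (sub _ xpq) _ _ ij.
have e2 : e * e = 1 by case: e1 => ->; rewrite ?mulrNN mulr1.
have -> : x = (e * x) * e by rewrite mulrAC e2 mul1r.
by rewrite /component hU ?pos // !mxE ler_pM2l // pos.
Qed.

Lemma U0_cone (R : realType) N k (s : R) : (1 <= k <= N.-1)%N -> s = 1 \/ s = -1 ->
  [/\ minimizing_cone (fun x => U0 N k (s * x)),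
      forall x, \sum_(i < N) component (fun x => U0 N k (s * x)) i x = 0 &
      boundary [set x : R | 0 < euclidean_norm (U0 N k (s * x))] 0].
Proof.
move=> hk s1; split.
- split=> [t x t0|a b _]; last exact: U0_minimizer.
  apply/rowP => i.
  rewrite -[LHS]/(U0 N k (s * (t * x)) ord0 i) [RHS]mxE !component_U0 (mulrCA s).
  have -> : pospart (t * (s * x)) = t * pospart (s * x).
    rewrite !pospartE normrM (gtr0_norm t0); by field.
  by rewrite mulrCA.
- move=> x; under eq_bigr do rewrite /component /= component_U0.
  by rewrite -mulr_suml sum_coef // mul0r.
- have s2 : s * s = 1 by case: s1 => ->; rewrite ?mulrNN mulr1.
  have normE x : euclidean_norm (U0 N k (s * x)) = pospart (s * x).
    rewrite /euclidean_norm.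
    have -> : \sum_(i < N) U0 N k (s * x) ord0 i ^+ 2 = pospart (s * x) ^+ 2.
      under eq_bigr => i _ do rewrite (@component_U0 R N k i) exprMn.
      by rewrite -mulr_suml sum_coef_sqr // mul1r.
    by rewrite sqrtr_sqr ger0_norm // pospart_ge0.
  split.
    (* A point of the half-line [0 < s * x] at distance [e / 2] from 0. *)
    move=> V /nbhs_ballP[e /= e0 sub]; exists (s * (e / 2)).
    have e2 : 0 < e / 2 by rewrite divr_gt0.
    split; first by rewrite /= normE mulrA s2 mul1r pospart_ge // ltW.
    apply: sub; rewrite /ball /= sub0r normrN normrM (gtr0_norm e2).
    have -> : `|s| = 1 by case: s1 => ->; rewrite ?normrN normr1.
    by rewrite mul1r ltr_pdivrMr // ltr_pMr //; lra.
  by move=> /interior_subset /=; rewrite normE mulr0 pospart_le // ltxx.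
Qed.

Theorem proposition1p3 (R : realType) (N : nat) (hN : (2 <= N)%N)
    (U : R -> 'rV[R]_N) :
  [/\ minimizing_cone U,
      forall x, \sum_(i < N) component U i x = 0 &
      boundary [set x : R | 0 < euclidean_norm (U x)] 0]
  <->
  exists k : nat, (1 <= k <= N.-1)%N /\
    (U = U0 N k \/ U = (fun x : R => U0 N k (- x))).
Proof.
split=> [[[hU umin] U0sum [cl _]]|[k [hk UE]]]; last first.
  have [s s1 ->] : exists2 s : R, s = 1 \/ s = -1 & U = (fun x => U0 N k (s * x)).
    case: UE => ->.
      by exists 1; [left|apply/funext => x; rewrite mul1r].
    by exists (-1); [right|apply/funext => x; rewrite mulN1r].
  exact: U0_cone.
case: N hN U hU umin U0sum cl => // n hN U hU umin U0sum cl.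
have UE := cone_of_homogeneous hU.
have m2 : minimizer (-2) 2 U by apply: umin; lra.
have dA := minimizer_decreasing hU m2 (or_introl erefl).
have dB := minimizer_decreasing hU m2 (or_intror erefl).
have A0 := U0sum 1; have B0 := U0sum (-1); rewrite /component in A0 B0.
have coneE (C : 'rV[R]_n.+1) j : (forall i : 'I_n.+1, C ord0 i = coef n.+1 j i) ->
    forall x, pospart x *: C = U0 n.+1 j x.
  move=> CE x; apply/rowP => i.
  by rewrite -[RHS]/(U0 n.+1 j x ord0 i) [LHS]mxE component_U0 -CE mulrC.
have [A00|An0] := eqVneq (U 1) 0; last first.
  have mA : minimizer (-2) 2 (fun x => cone (U 1) (U (-1)) (1 * x)).
    have -> : (fun x => cone (U 1) (U (-1)) (1 * x)) = U; last by [].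
    by rewrite [RHS]UE; apply/funext => x; rewrite mul1r.
  have [j hj [B00 AE]] := cone_rigidity (or_introl erefl) dA dB A0 B0 An0 mA.
  exists j; split=> //; left; rewrite UE; apply/funext => x.
  by rewrite /cone B00 scaler0 addr0; exact: coneE.
have [B00|Bn0] := eqVneq (U (-1)) 0.
  (* If both half-lines carry 0, then [U] vanishes identically, whereas a closure point requires a
     point with positive norm. *)
  have [x [/= + _]] := cl setT filterT.
  rewrite UE A00 B00 /cone !scaler0 addr0 /euclidean_norm big1 ?sqrtr0 ?ltxx // => i _.
  by rewrite mxE expr0n.
(* The negative half-line is treated by the same rigidity result with [k = -1] and the two vectors
   exchanged. *)
have mB : minimizer (-2) 2 (fun x => cone (U (-1)) (U 1) (-1 * x)).
  have -> : (fun x => cone (U (-1)) (U 1) (-1 * x)) = U; last by [].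
  by rewrite [RHS]UE; apply/funext => x; rewrite /cone mulN1r opprK addrC.
have [j hj [_ BE]] := cone_rigidity (or_intror erefl) dB dA B0 A0 Bn0 mB.
exists j; split=> //; right; rewrite UE; apply/funext => x.
by rewrite /cone A00 scaler0 add0r; exact: coneE.
Qed.
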